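(* Let $m$ be odd, $q=2^m$ and $s=\sqrt{2q}$. Define eight relations on the quaternary Delsarte–Goethals code $\mathcal{DG}$ by: $(x,y)\in S_0$ iff $w_L(x-y)=0$; $S_1$ iff $w_L(x-y)=q-\sqrt{2q}$; $S_2$ iff $w_L(x-y)=q-\sqrt{q/2}$; $S_3$ iff $w_L(x-y)=q$ and $x-y\in\mathcal{K}$; $S_4$ iff $w_L(x-y)=q$ and $x-y\notin\mathcal{K}$; $S_5$ iff $w_L(x-y)=q+\sqrt{q/2}$; $S_6$ iff $w_L(x-y)=q+\sqrt{2q}$; $S_7$ iff $w_L(x-y)=2q$. Then $(\mathcal{DG},\{S_i\}_{i=0}^{7})$ is a $7$-class (translation, commutative, symmetric) association scheme. With columns indexed by $S_0,\dots,S_7$ in this order and a suitable ordering of the primitive idempotents, its first eigenmatrix is the $8\times 8$ matrix $P$ whose rows are $(1,\ \tfrac{s^6}{24}-\tfrac{s^4}{8}+\tfrac{s^2}{12},\ \tfrac{s^6}{12}+\tfrac{s^4}{2}-\tfrac{4s^2}{3},\ 2s^2-2,\ \tfrac{s^6}{4}-\tfrac{3s^4}{4}+\tfrac{s^2}{2},\ \tfrac{s^6}{12}+\tfrac{s^4}{2}-\tfrac{4s^2}{3},\ \tfrac{s^6}{24}-\tfrac{s^4}{8}+\tfrac{s^2}{12},\ 1)$; $(1,\ -\tfrac{s^4}{12}+\tfrac{s^2}{12},\ \tfrac{s^4}{3}-\tfrac{4s^2}{3},\ 2s^2-2,\ -\tfrac{s^4}{2}+\tfrac{s^2}{2},\ \tfrac{s^4}{3}-\tfrac{4s^2}{3},\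 -\tfrac{s^4}{12}+\tfrac{s^2}{12},\ 1)$; $(1,\ \tfrac{s^5}{12}-\tfrac{s^3}{4}+\tfrac{s}{6},\ \tfrac{s^5}{12}+\tfrac{s^3}{2}-\tfrac{4s}{3},\ 0,\ 0,\ -\tfrac{s^5}{12}-\tfrac{s^3}{2}+\tfrac{4s}{3},\ -\tfrac{s^5}{12}+\tfrac{s^3}{4}-\tfrac{s}{6},\ -1)$; $(1,\ -\tfrac{s^3}{6}+\tfrac{s}{6},\ \tfrac{s^3}{3}-\tfrac{4s}{3},\ 0,\ 0,\ -\tfrac{s^3}{3}+\tfrac{4s}{3},\ \tfrac{s^3}{6}-\tfrac{s}{6},\ -1)$; $(1,\ \tfrac{s^4}{8}-\tfrac{s^2}{4},\ 0,\ -2,\ -\tfrac{s^4}{4}+\tfrac{s^2}{2},\ 0,\ \tfrac{s^4}{8}-\tfrac{s^2}{4},\ 1)$; $(1,\ -\tfrac{s^2}{4},\ 0,\ -2,\ \tfrac{s^2}{2},\ 0,\ -\tfrac{s^2}{4},\ 1)$; $(1,\ \tfrac{s^3}{12}+\tfrac{s}{6},\ -\tfrac{s^3}{6}-\tfrac{4s}{3},\ 0,\ 0,\ \tfrac{s^3}{6}+\tfrac{4s}{3},\ -\tfrac{s^3}{12}-\tfrac{s}{6},\ -1)$; $(1,\ \tfrac{s^4}{24}+\tfrac{s^2}{12},\ -\tfrac{s^4}{6}-\tfrac{4s^2}{3},\ 2s^2-2,\ \tfrac{s^4}{4}+\tfrac{s^2}{2},\ -\tfrac{s^4}{6}-\tfrac{4s^2}{3},\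 \tfrac{s^4}{24}+\tfrac{s^2}{12},\ 1)$, and its second eigenmatrix is $Q=4q^3P^{-1}$.
   Context: Let $m\ge1$, $q=2^m$. The Galois ring $R=GR(4,m)$ is $\mathbb{Z}_4[x]/(f(x))$ with $f$ monic of degree $m$ whose reduction mod 2 is irreducible; $|R|=4^m$. Let $\mu:R\to\mathbb{F}_q$ be reduction mod $2$. Let $\beta\in R^*$ have multiplicative order $2^m-1$ and $\mathcal{T}=\{0,1,\beta,\dots,\beta^{2^m-2}\}$ (Teichmüller set); every $z\in R$ is uniquely $z=A+2B$ with $A,B\in\mathcal{T}$. The Frobenius map is $\sigma(A+2B)=A^2+2B^2$ and the trace $\mathrm{T}:R\to\mathbb{Z}_4$ is $\mathrm{T}(z)=\sum_{i=0}^{m-1}\sigma^i(z)$. For $u\in\mathbb{Z}_4,a\in R,b\in\mathcal{T}$ let $\mathbf{c}(u,a,b)\in\mathbb{Z}_4^{q}$ be indexed by $x\in\mathcal{T}$ with $\mathbf{c}(u,a,b)_x=u+\mathrm{T}(ax+2bx^3)$. The Delsarte–Goethals code is $\mathcal{DG}=\{\mathbf{c}(u,a,b):u\in\mathbb{Z}_4,a\in R,b\in\mathcal{T}\}$ (an additive group of order $4q^3$), and the Kerdock code is $\mathcal{K}=\{\mathbf{c}(u,a,0)\}\subseteq\mathcal{DG}$. The Lee weight $w_L$ of a vector in $\mathbb{Z}_4^q$ is the sum of the Lee weights of its coordinates, where $w_L(0)=0$, $w_L(1)=w_L(3)=1$, $w_L(2)=2$. For a commutative association scheme on $X$ with adjacency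 matrices $A_j$ and primitive idempotents $E_i$, the first eigenmatrix $P$ is defined by $A_j=\sum_i P_{ij}E_i$ and the second eigenmatrix $Q$ by $E_j=\frac1{|X|}\sum_i Q_{ij}A_i$.
   Formalization: The formal theorem assumes m > 1 in addition to m odd (so m ≥ 3), because for m = 1 the claim fails: q − √(2q) = 0, so S_0 and S_1 coincide. *)

(* Defs.v *)
From HB Require Import structures.
From mathcomp Require Import all_boot all_order all_algebra all_field.
Set Implicit Arguments. Unset Strict Implicit. Unset Printing Implicit Defensive.
Import Order.TTheory GRing.Theory Num.Theory.
Local Open Scope ring_scope.

(* The Galois ring GR(4,m) = Z_4[x]/(f(x)), f monic of degree m.            *)
(* Elements are represented by their coefficient vectors (reduced residues  *)
(* of degree < m); multiplication is polynomial multiplication followed by  *)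
(* reduction modulo the monic polynomial f.                                 *)

Definition GR (m : nat) := 'rV['Z_4]_m.

Definition toP (m : nat) (z : GR m) : {poly 'Z_4} := \sum_(i < m) (z 0 i)%:P * 'X^i.

Definition ofP (m : nat) (f p : {poly 'Z_4}) : GR m :=
  \row_(i < m) (Pdiv.Ring.rmodp p f)`_i.

Definition grmul (m : nat) (f : {poly 'Z_4}) (x y : GR m) : GR m :=
  ofP m f (toP x * toP y).

Definition grone (m : nat) (f : {poly 'Z_4}) : GR m := ofP m f 1.

Definition grexp (m : nat) (f : {poly 'Z_4}) (x : GR m) (k : nat) : GR m :=
  iter k (grmul f x) (grone m f).

Definition red2 (x : 'Z_4) : 'F_2 := (val x)%:R.

Definition beta_order (m : nat) (f : {poly 'Z_4}) (beta : GR m) : Prop :=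
  grexp f beta (2 ^ m - 1) = grone m f /\
  (forall k, (0 < k < 2 ^ m - 1)%N -> grexp f beta k != grone m f).

Definition teich (m : nat) (f : {poly 'Z_4}) (beta : GR m) : {set GR m} :=
  [set z | (z == 0) || [exists k : 'I_(2 ^ m - 1), z == grexp f beta k]].

Definition frob (m : nat) (f : {poly 'Z_4}) (beta : GR m) (z : GR m) : GR m :=
  match [pick p : GR m * GR m |
          (p.1 \in teich f beta) && (p.2 \in teich f beta)
          && (z == p.1 + (p.2 + p.2))] with
  | Some p => grmul f p.1 p.1 + (grmul f p.2 p.2 + grmul f p.2 p.2)
  | None => z
  end.

(* trace T(z) = sum_{i<m} sigma^i(z), an element of Z_4 (viewed inside R as
   a constant residue; we read off its constant coefficient) *)
Definition trR (m : nat) (f : {poly 'Z_4}) (beta : GR m) (z : GR m) : GR m :=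
  \sum_(i < m) iter i (frob f beta) z.

Definition tr (m : nat) (f : {poly 'Z_4}) (beta : GR m) (z : GR m) : 'Z_4 :=
  (toP (trR f beta z))`_0.

(* words of Z_4^q indexed by x in the Teichmuller set; represented as
   functions on R that vanish outside the Teichmuller set *)
Definition word (m : nat) := {ffun GR m -> 'Z_4}.

Definition cw (m : nat) (f : {poly 'Z_4}) (beta : GR m)
    (u : 'Z_4) (a b : GR m) : word m :=
  [ffun x => if x \in teich f beta then
     u + tr f beta (grmul f a x + grmul f (b + b) (grexp f x 3))
   else 0].

Definition DG (m : nat) (f : {poly 'Z_4}) (beta : GR m) : {set word m} :=
  [set w | [exists u : 'Z_4, exists a : GR m, exists b : GR m,
             (b \in teich f beta) && (w == cw f beta u a b)]].

Definition Kerdock (m : nat) (f : {poly 'Z_4}) (beta : GR m) : {set word m} :=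
  [set w | [exists u : 'Z_4, exists a : GR m, w == cw f beta u a 0]].

Definition leeZ4 (x : 'Z_4) : nat :=
  (if val x == 0 then 0 else if val x == 2 then 2 else 1)%N.

Definition leew (m : nat) (f : {poly 'Z_4}) (beta : GR m) (w : word m) : nat :=
  (\sum_(x in teich f beta) leeZ4 (w x))%N.

Definition Srel (m : nat) (f : {poly 'Z_4}) (beta : GR m) (i : 'I_8)
    (x y : word m) : bool :=
  let q : algC := (2 ^ m)%:R in
  let w : algC := (leew f beta (x - y))%:R in
  if val i == 0%N then w == 0
  else if val i == 1%N then w == q - sqrtC (2 * q)
  else if val i == 2%N then w == q - sqrtC (q / 2)
  else if val i == 3%N then (w == q) && (x - y \in Kerdock f beta)
  else if val i == 4%N then (w == q) && (x - y \notin Kerdock f beta)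
  else if val i == 5%N then w == q + sqrtC (q / 2)
  else if val i == 6%N then w == q + sqrtC (2 * q)
  else w == 2 * q.

Definition is_assoc_scheme (n d : nat) (Rl : 'I_d.+1 -> rel 'I_n) : Prop :=
  [/\ (forall x y, exists! i, Rl i x y),
      (forall x y, Rl ord0 x y = (x == y)),
      (forall i, exists x y, Rl i x y),
      (forall i, exists i', forall x y, Rl i x y = Rl i' y x)
    & (forall i j k x y x' y', Rl k x y -> Rl k x' y' ->
         #|[set z | Rl i x z && Rl j z y]| = #|[set z | Rl i x' z && Rl j z y']|)].

Definition commutative_scheme (n d : nat) (Rl : 'I_d.+1 -> rel 'I_n) : Prop :=
  forall i j x y,
    #|[set z | Rl i x z && Rl j z y]| = #|[set z | Rl j x z && Rl i z y]|.

Definition symmetric_scheme (n d : nat) (Rl : 'I_d.+1 -> rel 'I_n) : Prop :=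
  forall i x y, Rl i x y = Rl i y x.

Definition translation_scheme (V : zmodType) (d : nat) (X : {pred V})
    (S : 'I_d.+1 -> rel V) : Prop :=
  [/\ 0 \in X, (forall x y, x \in X -> y \in X -> x - y \in X)
    & (forall i x y z, x \in X -> y \in X -> z \in X ->
         S i (x + z) (y + z) = S i x y)].

Definition adjmx (n : nat) (Rl : rel 'I_n) : 'M[algC]_n :=
  \matrix_(x, y) (Rl x y)%:R.

Definition in_BM (n d : nat) (A : 'I_d.+1 -> 'M[algC]_n) (M : 'M[algC]_n) :=
  exists c : 'I_d.+1 -> algC, M = \sum_j c j *: A j.

Definition is_idem (n : nat) (M : 'M[algC]_n) := M *m M = M.

Definition primitive_idem (n d : nat) (A : 'I_d.+1 -> 'M[algC]_n)
    (E : 'M[algC]_n) : Prop :=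
  [/\ in_BM A E, is_idem E, E != 0 &
      ~ (exists F G, [/\ in_BM A F /\ in_BM A G, is_idem F /\ is_idem G,
                         F != 0 /\ G != 0, F *m G = 0 & E = F + G])].

Definition primitive_idem_enum (n d : nat) (A : 'I_d.+1 -> 'M[algC]_n)
    (E : 'I_d.+1 -> 'M[algC]_n) : Prop :=
  [/\ injective E, (forall i, primitive_idem A (E i))
    & (forall F, primitive_idem A F -> exists i, F = E i)].

Definition first_eigenmatrix (n d : nat) (A E : 'I_d.+1 -> 'M[algC]_n)
    (P : 'M[algC]_d.+1) : Prop :=
  forall j, A j = \sum_i P i j *: E i.

Definition second_eigenmatrix (n d : nat) (A E : 'I_d.+1 -> 'M[algC]_n)
    (Q : 'M[algC]_d.+1) : Prop :=
  forall j, E j = (n%:R)^-1 *: \sum_i Q i j *: A i.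

Definition Prows (s : algC) : seq (seq algC) :=
 [:: [:: 1; s^+6/24 - s^+4/8 + s^+2/12; s^+6/12 + s^+4/2 - 4*s^+2/3; 2*s^+2 - 2;
         s^+6/4 - 3*s^+4/4 + s^+2/2; s^+6/12 + s^+4/2 - 4*s^+2/3;
         s^+6/24 - s^+4/8 + s^+2/12; 1];
     [:: 1; - s^+4/12 + s^+2/12; s^+4/3 - 4*s^+2/3; 2*s^+2 - 2;
         - s^+4/2 + s^+2/2; s^+4/3 - 4*s^+2/3; - s^+4/12 + s^+2/12; 1];
     [:: 1; s^+5/12 - s^+3/4 + s/6; s^+5/12 + s^+3/2 - 4*s/3; 0; 0;
         - s^+5/12 - s^+3/2 + 4*s/3; - s^+5/12 + s^+3/4 - s/6; -1];
     [:: 1; - s^+3/6 + s/6; s^+3/3 - 4*s/3; 0; 0; - s^+3/3 + 4*s/3;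
         s^+3/6 - s/6; -1];
     [:: 1; s^+4/8 - s^+2/4; 0; -2; - s^+4/4 + s^+2/2; 0; s^+4/8 - s^+2/4; 1];
     [:: 1; - s^+2/4; 0; -2; s^+2/2; 0; - s^+2/4; 1];
     [:: 1; s^+3/12 + s/6; - s^+3/6 - 4*s/3; 0; 0; s^+3/6 + 4*s/3;
         - s^+3/12 - s/6; -1];
     [:: 1; s^+4/24 + s^+2/12; - s^+4/6 - 4*s^+2/3; 2*s^+2 - 2;
         s^+4/4 + s^+2/2; - s^+4/6 - 4*s^+2/3; s^+4/24 + s^+2/12; 1]].

Definition Pmx (s : algC) : 'M[algC]_8 :=
  \matrix_(i < 8, j < 8) nth 0 (nth [::] (Prows s) i) j.

Definition DGrel (m : nat) (f : {poly 'Z_4}) (beta : GR m) (i : 'I_8)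
    : rel 'I_#|DG f beta| :=
  fun a b => Srel f beta i (enum_val a) (enum_val b).

Arguments DGrel m f beta i : clear implicits.

Definition DGadj (m : nat) (f : {poly 'Z_4}) (beta : GR m) (j : 'I_8)
    : 'M[algC]_#|DG f beta| := adjmx (DGrel m f beta j).
Arguments DGadj m f beta j : clear implicits.

(* Main.v *)
(** A character of DG has a syndrome (t, A, C) in Z_4 x R x F_q as its label, and
    its sum over a relation S_j is an entry of the eigenmatrix. The scheme
    property follows once these sums take at most eight patterns, namely the rows
    of the invertible matrix P: the corresponding sums of rank-one projections are
    then orthogonal idempotents spanning the same space as the adjacency matrices.

    Write q - lambda for the Lee weight, so that lambda is the real part of an
    exponential sum of squared modulus q |rad| or 0, where rad is the radical of a quadratic
    form, of order 1, 2 or 4. Hence |lambda| is sqrt (q / 2) when rad = 0, and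
    0 or sqrt (2 q) otherwise, outside the subgroup H of codewords with a in 2R
    and b = 0. Moreover rad only depends on the class modulo H, so S_2 u S_5 is a
    union of H-cosets and the character sum over it vanishes unless the character
    is trivial on H. The other sums are determined by their moments against
    powers of lambda, which count the representations of the syndrome as a sum of
    at most four signed columns (1, x, x^3). *)

(* After translation the code depends on the Galois ring only through Q(x) = T([x]), with [ ] the
   Teichmuller lift: a map from F_q to Z_4, invariant under squaring, with Q(x + y) = Q(x) + Q(y) +
   2 Q(xy). All counting becomes polynomial algebra in characteristic 2, and one group of quadruples
   serves both for codewords and for labels of characters.

   The difficulty is to get enough equations from few moments. Adding the constant word 2 negates
   lambda, so a row of sums is symmetric or antisymmetric under reversal of the classes, according
   to the parity of t. For t odd, moments 1 and 3 determine the two remaining unknowns. For t even,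
   S_3 comes from the subgroup H and S_4 from the total; the fourth moment is used only for t = A =
   0, since otherwise the sum over S_2 vanishes and the second moment suffices. The moments take few
   values because, off the zero syndrome, the underlying quadratic and cubic systems have either no
   solution or a fixed number of them, and because the trace of 1 is 1 for m odd, which keeps two of
   these systems from being solvable together. *)
Require Import Defs.
From HB Require Import structures.
From mathcomp Require Import all_boot all_order all_fingroup all_algebra all_field.
From mathcomp Require Import ring lra zify.
Set Implicit Arguments. Unset Strict Implicit. Unset Printing Implicit Defensive.
Import Order.TTheory GRing.Theory Num.Theory.
Local Open Scope ring_scope.

(** * Bose-Mesner algebras from orthogonal idempotents *)

Section BoseMesner.
Variables (n d : nat) (Rl : 'I_d.+1 -> rel 'I_n).
Variables (P : 'M[algC]_d.+1) (E : 'I_d.+1 -> 'M[algC]_n).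
Local Notation A := (fun j => adjmx (Rl j)).
Hypothesis Rl_part : forall x y, exists! i, Rl i x y.
Hypothesis Rl_ne : forall i, exists x y, Rl i x y.
Hypothesis AE : forall j, adjmx (Rl j) = \sum_i P i j *: E i.
Hypothesis P_unit : P \in unitmx.
Hypothesis EE : forall i k, E i *m E k = if i == k then E i else 0.

Lemma sum_adjE (c : 'I_d.+1 -> algC) j x y : Rl j x y ->
  (\sum_k c k *: adjmx (Rl k)) x y = c j.
Proof.
move=> Rj; rewrite summxE (bigD1 j) //= !mxE Rj mulr1 big1 ?addr0 // => k kj.
rewrite !mxE; case Rk: (Rl k x y); last by rewrite mulr0.
have [i [_ iu]] := Rl_part x y.
by have ij := iu j Rj; have ik := iu k Rk; rewrite -ij -ik eqxx in kj.
Qed.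

Lemma E_adj i : E i = \sum_j invmx P j i *: adjmx (Rl j).
Proof.
under eq_bigr do rewrite AE scaler_sumr.
rewrite exchange_big /=.
transitivity (\sum_k (P *m invmx P) k i *: E k).
  rewrite mulmxV // (bigD1 i) //= mxE eqxx scale1r big1 ?addr0 // => k /negPf ki.
  by rewrite mxE ki scale0r.
apply: eq_bigr => k _; rewrite mxE scaler_suml; apply: eq_bigr => j _.
by rewrite scalerA mulrC.
Qed.

(** Nonempty relations make the adjacency matrices independent, so a zero idempotent would give a
    zero column of [invmx P]. *)
Lemma E_neq0 i : E i != 0.
Proof.
apply/eqP => E0; have: (P *m invmx P) i i = 0.
  rewrite mxE big1 // => j _; suff -> : invmx P j i = 0 by rewrite mulr0.
  have [x [y Rj]] := Rl_ne j.
  by rewrite -(sum_adjE (invmx P ^~ i) Rj) -E_adj E0 mxE.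
by rewrite mulmxV // mxE eqxx => /eqP; rewrite oner_eq0.
Qed.

Lemma in_BM_E M : in_BM A M <-> exists e, M = \sum_i e i *: E i.
Proof.
split=> -[c ->].
  exists (fun i => \sum_j c j * P i j).
  under eq_bigr do rewrite AE scaler_sumr.
  rewrite exchange_big; apply: eq_bigr => i _.
  by rewrite scaler_suml; apply: eq_bigr => j _; rewrite scalerA.
exists (fun j => \sum_i c i * invmx P j i).
under eq_bigr do rewrite E_adj scaler_sumr.
rewrite exchange_big; apply: eq_bigr => i _.
by rewrite scaler_suml; apply: eq_bigr => j _; rewrite scalerA.
Qed.

Lemma mulE (e f : 'I_d.+1 -> algC) :
  (\sum_i e i *: E i) *m (\sum_i f i *: E i) = \sum_i (e i * f i) *: E i.
Proof.
rewrite mulmx_suml; apply: eq_bigr => i _.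
rewrite mulmx_sumr (bigD1 i) //= big1 ?addr0 => [|k /negPf ki].
  by rewrite -scalemxAl -scalemxAr EE eqxx scalerA.
by rewrite -scalemxAl -scalemxAr EE eq_sym ki !scaler0.
Qed.

Lemma E_sum i : E i = \sum_k (k == i)%:R *: E k.
Proof.
rewrite (bigD1 i) //= eqxx scale1r big1 ?addr0 // => k /negPf ->.
by rewrite scale0r.
Qed.

Lemma mulE_l i (e : 'I_d.+1 -> algC) : E i *m (\sum_k e k *: E k) = e i *: E i.
Proof.
rewrite [in LHS]E_sum mulE (bigD1 i) //= eqxx mul1r big1 ?addr0 // => k /negPf ->.
by rewrite mul0r scale0r.
Qed.

Lemma E_coef_inj (e f : 'I_d.+1 -> algC) :
  \sum_k e k *: E k = \sum_k f k *: E k -> e =1 f.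
Proof.
move=> ef i; have := congr1 (mulmx (E i)) ef; rewrite !mulE_l => /eqP.
by rewrite -subr_eq0 -scalerBl scaler_eq0 (negPf (E_neq0 i)) orbF subr_eq0 => /eqP.
Qed.

Lemma idem_coef (e : 'I_d.+1 -> algC) :
  is_idem (\sum_k e k *: E k) -> forall i, e i = 0 \/ e i = 1.
Proof.
rewrite /is_idem mulE => /E_coef_inj H i; have /eqP := H i.
rewrite -subr_eq0 -{3}[e i]mulr1 -mulrBr mulf_eq0 subr_eq0.
by case/orP => /eqP; [left | right].
Qed.

Lemma BM_in i : in_BM A (E i).
Proof. by apply/in_BM_E; exists (fun k => (k == i)%:R); exact: E_sum. Qed.

Lemma E_idem i : is_idem (E i).
Proof. by rewrite /is_idem EE eqxx. Qed.

(** An idempotent has coefficients 0 and 1 in the basis E. A splitting of [E i] writes the indicator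
    of i as a sum of two such families with product 0, so one of them vanishes. *)
Lemma E_primitive i : primitive_idem A (E i).
Proof.
split; [exact: BM_in | exact: E_idem | exact: E_neq0 |].
case=> F [G [[/in_BM_E [f ->] /in_BM_E [g ->]] [idf idg] [F0 G0] FG0 EFG]].
have fg : f i * g i = 0.
  move: FG0; rewrite mulE => FG0.
  have: \sum_k (f k * g k) *: E k = \sum_k 0 *: E k.
    by rewrite FG0 big1 // => k _; rewrite scale0r.
  by move/E_coef_inj.
have sumz (e : 'I_d.+1 -> algC) : e =1 (fun=> 0) -> \sum_k e k *: E k = 0.
  by move=> e0; rewrite big1 // => k _; rewrite e0 scale0r.
have ffg k : f k + g k = (k == i)%:R.
  suff /E_coef_inj -> : \sum_k (f k + g k) *: E k = \sum_k (k == i)%:R *: E k by [].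
  by rewrite -E_sum EFG -big_split; apply: eq_bigr => l _; rewrite scalerDl.
have nz k : k != i -> f k = 0 /\ g k = 0.
  move=> /negPf ki; have := ffg k; rewrite ki.
  case: (idem_coef idf k) => ->; case: (idem_coef idg k) => -> //.
  - by rewrite add0r => /eqP; rewrite oner_eq0.
  - by rewrite addr0 => /eqP; rewrite oner_eq0.
  - by move/eqP; rewrite -(natrD _ 1 1) pnatr_eq0.
have [f0|g0] : f i = 0 \/ g i = 0.
- by move/eqP: fg; rewrite mulf_eq0 => /orP [] /eqP; [left | right].
- case/eqP: F0; apply: sumz => k; case: (eqVneq k i) => [->//|ki].
  by case: (nz k ki).
- case/eqP: G0; apply: sumz => k; case: (eqVneq k i) => [->//|ki].
  by case: (nz k ki).
Qed.

(** If F has coefficient 1 at i, it is the orthogonal sum of [E i] and an idempotent remainder,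
    which primitivity forces to be zero. *)
Lemma primitive_E F : primitive_idem A F -> exists i, F = E i.
Proof.
case=> /in_BM_E [f Ff] idF F0 prim; rewrite Ff in idF F0 prim *.
have [i fi] : exists i, f i != 0.
  apply/existsP; apply: contraNT F0; rewrite negb_exists => /forallP f0.
  by rewrite big1 // => k _; have := f0 k; rewrite negbK => /eqP ->; rewrite scale0r.
have {}fi : f i = 1.
  by case: (idem_coef idF i) fi => -> //; rewrite eqxx.
exists i; case: (eqVneq (\sum_k f k *: E k) (E i)) => // ne; case: prim.
pose g k := f k - (k == i)%:R.
have EG : \sum_k f k *: E k = E i + \sum_k g k *: E k.
  by rewrite [E i]E_sum -big_split; apply: eq_bigr => k _ /=; rewrite -scalerDl subrKC.
exists (E i), (\sum_k g k *: E k); split => //.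
- split; first exact: BM_in.
  by apply/in_BM_E; exists g.
- split; first exact: E_idem.
  rewrite /is_idem mulE; apply: eq_bigr => k _; congr (_ *: _); rewrite /g.
  case: (eqVneq k i) => [->|_]; first by rewrite fi subrr mulr0.
  by rewrite subr0; case: (idem_coef idF k) => ->; rewrite ?mulr0 ?mulr1.
- split; first exact: E_neq0.
  by apply: contraNneq ne => g0; rewrite EG g0 addr0.
- by rewrite mulE_l /g eqxx fi subrr scale0r.
Qed.

Lemma E_inj : injective E.
Proof.
move=> i k Eik; apply/eqP; case: eqP => // /eqP /negPf ik.
have := EE i k; rewrite ik -Eik EE eqxx => E0.
by have := E_neq0 i; rewrite E0 eqxx.
Qed.

Lemma E_enum : primitive_idem_enum A E.
Proof. by split; [exact: E_inj | exact: E_primitive | exact: primitive_E]. Qed.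

Lemma mul_adjE i j x y :
  (adjmx (Rl i) *m adjmx (Rl j)) x y = #|[set z | Rl i x z && Rl j z y]|%:R.
Proof.
rewrite mxE -sum1_card natr_sum [RHS]big_mkcond; apply: eq_bigr => z _.
by rewrite !mxE inE; case: (Rl i x z); case: (Rl j z y); rewrite ?mul0r ?mulr0 ?mul1r.
Qed.

Lemma mul_adj_in i j : exists c, adjmx (Rl i) *m adjmx (Rl j) = \sum_k c k *: adjmx (Rl k).
Proof.
by apply/in_BM_E; rewrite !AE mulE; eexists.
Qed.

(** The product of two adjacency matrices stays in their span, so its entry at (x, y) depends only
    on the relation of x to y. *)
Lemma intersection_number i j k x y x' y' : Rl k x y -> Rl k x' y' ->
  #|[set z | Rl i x z && Rl j z y]| = #|[set z | Rl i x' z && Rl j z y']|.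
Proof.
move=> R R'; have [c Ec] := mul_adj_in i j.
apply/eqP; rewrite -(eqr_nat algC) -!mul_adjE Ec.
by rewrite (sum_adjE _ R) (sum_adjE _ R').
Qed.

Lemma BM_commutative : commutative_scheme Rl.
Proof.
move=> i j x y; apply/eqP; rewrite -(eqr_nat algC) -!mul_adjE !AE !mulE.
by apply/eqP; congr (fun_of_matrix _ x y); apply: eq_bigr => k _; rewrite mulrC.
Qed.

Lemma BM_second : second_eigenmatrix A E (n%:R *: invmx P).
Proof.
move=> j; rewrite E_adj scaler_sumr; apply: eq_bigr => i _.
have n0 : (n%:R : algC) != 0.
  rewrite pnatr_eq0; have [x _] := Rl_ne ord0.
  by case: (n) x => // -[].
by rewrite mxE !scalerA mulrA mulVf // mul1r.
Qed.

End BoseMesner.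

(** * Idempotents from a character table whose eigenvalue patterns are the rows of P *)

Section CharacterIdempotents.
Variables (n d : nat) (I : finType) (X : 'I_n -> I -> algC) (N : algC).
Variables (Rl : 'I_d.+1 -> rel 'I_n) (P : 'M[algC]_d.+1) (ty : I -> 'I_d.+1).
Hypothesis N0 : N != 0.
Hypothesis X_col : forall s s', \sum_x (X x s)^* * X x s' = if s == s' then N else 0.
Hypothesis X_row : forall x y, \sum_s X x s * (X y s)^* = if x == y then N else 0.
Hypothesis X_eigen : forall j x s,
  \sum_y (Rl j x y)%:R * X y s = P (ty s) j * X x s.

Definition char_idem i : 'M[algC]_n :=
  \matrix_(x, y) (N^-1 * \sum_(s | ty s == i) X x s * (X y s)^*).

(** Multiply the adjacency matrix on the right by the identity, written through row orthogonality as
    a sum of rank-one matrices, and group the characters by type. *)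
Lemma adj_char_idem j : adjmx (Rl j) = \sum_i P i j *: char_idem i.
Proof.
apply/matrixP => x y; rewrite summxE.
transitivity (N^-1 * \sum_s P (ty s) j * (X x s * (X y s)^*)).
  rewrite mxE; transitivity (N^-1 * \sum_z (Rl j x z)%:R * \sum_s X z s * (X y s)^*).
    under eq_bigr do rewrite X_row.
    rewrite (bigD1 y) //= big1 => [|z /negPf zy]; last by rewrite zy mulr0.
    by rewrite eqxx addr0 mulrCA mulVf ?mulr1.
  congr (_ * _); under eq_bigr do rewrite mulr_sumr.
  rewrite exchange_big; apply: eq_bigr => s _ /=.
  by rewrite mulrA -X_eigen mulr_suml; apply: eq_bigr => z _; rewrite mulrA.
rewrite (partition_big ty xpredT) //= mulr_sumr; apply: eq_bigr => i _.
rewrite !mxE mulrCA; congr (_ * _); rewrite mulr_sumr.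
by apply: eq_bigr => s /eqP ->.
Qed.

Lemma char_idem_mul i k : char_idem i *m char_idem k = if i == k then char_idem i else 0.
Proof.
apply/matrixP => x y; rewrite mxE.
transitivity (N^-1 * N^-1 * \sum_(s | ty s == i) \sum_(s' | ty s' == k)
   X x s * (X y s')^* * \sum_z (X z s)^* * X z s').
  under eq_bigr do rewrite !mxE mulrACA big_distrlr.
  rewrite -mulr_sumr exchange_big; congr (_ * _); apply: eq_bigr => s _.
  rewrite exchange_big; apply: eq_bigr => s' _ /=.
  by rewrite mulr_sumr; apply: eq_bigr => z _; ring.
transitivity (N^-1 * \sum_(s | ty s == i) if ty s == k then X x s * (X y s)^* else 0).
  rewrite -mulrA; congr (_ * _); rewrite mulr_sumr; apply: eq_bigr => s _.
  under eq_bigr do rewrite X_col.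
  rewrite big_mkcond (bigD1 s) //= big1 ?addr0 => [|s' /negPf s's]; last first.
    by rewrite [s == s']eq_sym s's mulr0 if_same.
  by rewrite eqxx; case: ifP; rewrite ?mulr0 // mulrCA mulVf ?mulr1.
case: eqP => [<-|/eqP ik]; rewrite mxE.
  by congr (_ * _); apply: eq_bigr => s ->.
by rewrite big1 ?mulr0 // => s /eqP ->; rewrite (negPf ik).
Qed.

End CharacterIdempotents.

(** * Invertibility of the 8 x 8 eigenmatrix *)

Lemma sum8 (f : 'I_8 -> algC) :
  \sum_j f j = f 0 + f 1 + f 2 + f 3 + f 4 + f 5 + f 6 + f 7.
Proof.
rewrite !big_ord_recl big_ord0 addr0 !addrA.
by do !congr (_ + _); congr f; apply/val_inj.
Qed.

Lemma I8_ind (P : 'I_8 -> Prop) :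
  P 0 -> P 1 -> P 2 -> P 3 -> P 4 -> P 5 -> P 6 -> P 7 -> forall j, P j.
Proof.
move=> p0 p1 p2 p3 p4 p5 p6 p7 [[|[|[|[|[|[|[|[|//]]]]]]]] i].
- by rewrite (_ : Ordinal i = 0) //; apply/val_inj.
- by rewrite (_ : Ordinal i = 1) //; apply/val_inj.
- by rewrite (_ : Ordinal i = 2) //; apply/val_inj.
- by rewrite (_ : Ordinal i = 3) //; apply/val_inj.
- by rewrite (_ : Ordinal i = 4) //; apply/val_inj.
- by rewrite (_ : Ordinal i = 5) //; apply/val_inj.
- by rewrite (_ : Ordinal i = 6) //; apply/val_inj.
- by rewrite (_ : Ordinal i = 7) //; apply/val_inj.
Qed.

(** The second eigenmatrix in closed form. Since q = s^2 / 2, the code has 4 q^3 = s^6 / 2 words,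
    which is the scalar in [Pmx_Qmx]. *)
Definition Qrows (s : algC) : seq (seq algC) :=
  let a := s ^+ 4 / 12 + s ^+ 2 / 2 - 4 / 3 in
  let b := - s ^+ 2 / 6 - 4 / 3 in
  let c := s ^+ 2 / 3 - 4 / 3 in
  let x := s ^+ 4 / 6 - s ^+ 2 / 2 + 1 / 3 in
  let y := s ^+ 2 / 6 + 1 / 3 in
  let z := - s ^+ 2 / 3 + 1 / 3 in
  let d := s ^+ 4 / 4 - 3 * s ^+ 2 / 4 + 1 / 2 in
 [:: [:: 1; a; s ^+ 2; s ^+ 2 * a; s ^+ 4 / 2 - s ^+ 2 / 2; s ^+ 2 * d; s ^+ 2 * x; x];
     [:: 1; b; 2 * s; 2 * s * b; 3 * s ^+ 2 / 2; - 3 * s ^+ 2 / 2; 2 * s * y; y];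
     [:: 1; c; s; s * c; 0; 0; s * z; z];
     [:: 1; a; 0; 0; - s ^+ 2 / 2; - s ^+ 4 / 4 + s ^+ 2 / 2; 0; x];
     [:: 1; b; 0; 0; - s ^+ 2 / 2; s ^+ 2 / 2; 0; y];
     [:: 1; c; - s; - s * c; 0; 0; - s * z; z];
     [:: 1; b; - 2 * s; - 2 * s * b; 3 * s ^+ 2 / 2; - 3 * s ^+ 2 / 2; - 2 * s * y; y];
     [:: 1; a; - s ^+ 2; - s ^+ 2 * a; s ^+ 4 / 2 - s ^+ 2 / 2; s ^+ 2 * d; - s ^+ 2 * x; x]].

Definition Qmx (s : algC) : 'M[algC]_8 :=
  \matrix_(i < 8, j < 8) nth 0 (nth [::] (Qrows s) i) j.

Lemma Pmx_Qmx s : Pmx s *m Qmx s = (s ^+ 6 / 2)%:M.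
Proof.
apply/matrixP => i j; rewrite !mxE sum8 !mxE.
by elim/I8_ind: i; elim/I8_ind: j; rewrite /Qrows /=; field.
Qed.

Lemma Pmx_unit s : s != 0 -> Pmx s \in unitmx.
Proof.
move=> s0; have u : Pmx s *m ((2 / s ^+ 6) *: Qmx s) = 1%:M.
  by rewrite -scalemxAr Pmx_Qmx scale_scalar_mx; congr (_%:M); field.
by have [] := mulmx1_unit u.
Qed.

(** * The character sums of the code over a finite field *)

Definition omega (z : 'Z_4) : algC := 'i ^+ (val z).
Definition re4 (z : 'Z_4) : int := if z == 0 then 1 else if z == 2 then - 1 else 0.
Definition im4 (z : 'Z_4) : int := if z == 1 then 1 else if z == 3 then - 1 else 0.

Lemma Z4_ind (P : 'Z_4 -> Prop) : P 0 -> P 1 -> P 2 -> P 3 -> forall z, P z.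
Proof.
move=> P0 P1 P2 P3 [[|[|[|[|z]]]] hz] //.
- by have -> : Ordinal hz = 0 by apply/val_inj.
- by have -> : Ordinal hz = 1 by apply/val_inj.
- by have -> : Ordinal hz = 2 by apply/val_inj.
- by have -> : Ordinal hz = 3 by apply/val_inj.
Qed.

Lemma Z4E : (4 = 0 :> 'Z_4) * (3 = -1 :> 'Z_4) * (- 2 = 2 :> 'Z_4).
Proof. by do 2?split; apply/val_inj. Qed.

Lemma mulrn4 (z : 'Z_4) : z *+ 4 = 0.
Proof. by rewrite -mulr_natr Z4E mulr0. Qed.

Lemma mulr2n_opp (z : 'Z_4) : - (z *+ 2) = z *+ 2.
Proof. by apply/eqP; rewrite eq_sym -subr_eq0 opprK -mulrnDr mulrn4. Qed.

Lemma i4 : 'i ^+ 4 = 1 :> algC.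
Proof. by rewrite (exprM _ 2 2) sqrCi expr2 mulrNN mulr1. Qed.

Lemma omegaD x y : omega (x + y) = omega x * omega y.
Proof.
rewrite /omega (_ : val (x + y)%R = (val x + val y) %% 4)%N // -exprD.
by rewrite [in RHS](divn_eq (val x + val y)%N 4) exprD mulnC exprM i4 expr1n mul1r.
Qed.

Lemma omega0 : omega 0 = 1. Proof. exact: expr0. Qed.
Lemma omega2 : omega 2 = -1. Proof. exact: sqrCi. Qed.

Lemma omega_ri z : omega z = (re4 z)%:~R + 'i * (im4 z)%:~R.
Proof.
elim/Z4_ind: z; rewrite /omega /re4 /im4 /=.
- by rewrite expr0 mulr0 addr0.
- by rewrite expr1 mulr1 add0r.
- by rewrite sqrCi mulr0 addr0.
- by rewrite exprS sqrCi add0r.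
Qed.

Lemma re4N z : re4 (- z) = re4 z. Proof. by elim/Z4_ind: z. Qed.
Lemma im4N z : im4 (- z) = - im4 z. Proof. by elim/Z4_ind: z. Qed.

Lemma omegaN z : omega (- z) = (re4 z)%:~R - 'i * (im4 z)%:~R.
Proof. by rewrite omega_ri re4N im4N rmorphN mulrN. Qed.

Lemma omega_conj z : (omega z)^* = omega (- z).
Proof.
by rewrite omega_ri omegaN rmorphD rmorphM !rmorph_int /= conjCi mulNr.
Qed.

(** Squares are 0 or 1 modulo 4. The next two lemmas descend by halving, and pin down the real part
    of a Gaussian integer of norm 4^k or 2 * 4^k. *)
Lemma sumsq_even (a b : nat) : (4 %| a * a + b * b -> exists a' b', a = a'.*2 /\ b = b'.*2)%N.
Proof.
case/dvdnP=> k; exists a./2, b./2.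
have := odd_double_half a; have := odd_double_half b.
by move: (a./2) (b./2) => x y; case: (odd a); case: (odd b); nia.
Qed.

Lemma sumsq_pow4 (k a b : nat) : (a * a + b * b = 4 ^ k)%N -> a = 0%N \/ (a * a = 4 ^ k)%N.
Proof.
elim: k a b => [|k IHk] a b; first by rewrite expn0; case: a => [|[|a]] //; lia.
move=> h; have [|a' [b' [ea eb]]] := @sumsq_even a b; first by rewrite h expnS dvdn_mulr.
case: (IHk a' b'); rewrite expnS in h *; [lia | | ]; lia.
Qed.

Lemma sumsq_2pow4 (k a b : nat) : (a * a + b * b = 2 * 4 ^ k)%N -> (a * a = 4 ^ k)%N.
Proof.
elim: k a b => [|k IHk] a b.
  by rewrite expn0; case: a => [|[|a]] //; case: b => [|[|b]]; lia.
move=> h; have [|a' [b' [ea eb]]] := @sumsq_even a b.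
  by rewrite h expnS mulnCA dvdn_mulr.
by have := IHk a' b'; rewrite expnS in h *; lia.
Qed.

(** * The code modelled by a Z_4-valued quadratic form Q on F, standing for x |-> T([x]) *)

Section Abstract.
Variables (F : finFieldType) (m : nat) (Q : F -> 'Z_4).
Hypotheses (m_odd : odd m) (m_gt1 : (1 < m)%N) (cardF : #|F| = (2 ^ m)%N).
Hypothesis QD : forall x y, Q (x + y) = Q x + Q y + Q (x * y) *+ 2.
Hypothesis Qsqr : forall x, Q (x ^+ 2) = Q x.
Hypothesis Q1 : Q 1 *+ 2 = 2.

(** This is the absolute trace of F, with F_2 embedded in Z_4 as {0, 2}: it is additive, invariant
    under squaring, and D 1 = 2. *)
Definition D x := Q x *+ 2.

Lemma two0 : 2 = 0 :> F.
Proof.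
have: (#|F|%:R : F) = 0.
  have : \sum_(x : F) x = \sum_(x : F) (x + 1) by apply: (reindex_inj (addIr 1)).
  by move/eqP; rewrite big_split /= -subr_eq0 opprD addNKr oppr_eq0 sumr_const => /eqP.
by rewrite cardF natrX => /eqP; rewrite expf_eq0 => /andP[_ /eqP].
Qed.
Lemma natF k : k%:R = (odd k)%:R :> F.
Proof. by rewrite -{1}(odd_double_half k) -muln2 natrD natrM two0 mulr0 addr0. Qed.
Lemma three1 : 3 = 1 :> F. Proof. exact: natF. Qed.
Lemma four0 : 4 = 0 :> F. Proof. exact: natF. Qed.
Lemma five1 : 5 = 1 :> F. Proof. exact: natF. Qed.
Lemma six0 : 6 = 0 :> F. Proof. exact: natF. Qed.
Lemma oppN1 : -1 = 1 :> F.
Proof. by apply/eqP; rewrite -subr_eq0 -opprD oppr_eq0 -mulr2n two0. Qed.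
Lemma oppN2 : - (2) = 0 :> F. Proof. by rewrite two0 oppr0. Qed.
(** [ring] in characteristic 2: the listed equations reduce the numerical coefficients modulo 2. *)
Ltac ring2 := ring: two0 three1 four0 five1 six0 oppN1 oppN2.

Lemma addxx (x : F) : x + x = 0. Proof. by rewrite -mulr2n -mulr_natr two0 mulr0. Qed.
Lemma oppx (x : F) : - x = x.
Proof. by apply/eqP; rewrite eq_sym -subr_eq0 opprK addxx. Qed.
Lemma addx_eq0 (x y : F) : (x + y == 0) = (x == y).
Proof. by rewrite -{1}[y]oppx subr_eq0. Qed.
Lemma sqrD (x y : F) : (x + y) ^+ 2 = x ^+ 2 + y ^+ 2. Proof. ring2. Qed.

Lemma sqr_inj : injective (fun x : F => x ^+ 2).
Proof.
move=> x y /eqP; rewrite -addx_eq0 -sqrD sqrf_eq0 addx_eq0.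
by move/eqP.
Qed.

Lemma sum_sqr (f : F -> algC) : \sum_x f (x ^+ 2) = \sum_x f x.
Proof. by rewrite [RHS](reindex_inj sqr_inj). Qed.

Lemma Q0 : Q 0 = 0.
Proof.
by have := QD 0 0; rewrite mulr0 addr0 => ->; rewrite -(mulrnDr (Q 0) 2 2) mulrn4.
Qed.
Lemma D0 : D 0 = 0. Proof. by rewrite /D Q0 mul0rn. Qed.
Lemma DD x y : D (x + y) = D x + D y.
Proof. by rewrite /D QD (mulrnDl _ (Q x + Q y)) mulrnDl -(mulrnA _ 2 2) mulrn4 addr0. Qed.
Lemma Dsqr x : D (x ^+ 2) = D x. Proof. by rewrite /D Qsqr. Qed.
Lemma D1 : D 1 = 2. Proof. exact: Q1. Qed.
Lemma DN x : - D x = D x. Proof. exact: mulr2n_opp. Qed.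
Lemma Dxx x : D x + D x = 0. Proof. by rewrite -{1}DN addNr. Qed.
Lemma Q2 x : Q x *+ 2 = D x. Proof. by []. Qed.
(** For c nonzero, the shift x |-> x + 1/c adds D 1 = 2 to the argument and so changes the sign of
    every term. *)
Lemma sum_omegaD c : \sum_x omega (D (c * x)) = if c == 0 then #|F|%:R else 0.
Proof.
case: eqVneq => [->|c0].
  under eq_bigr do rewrite mul0r D0 omega0.
  by rewrite sumr_const.
set S := \sum_x _; suff: S = - S.
  by move/eqP; rewrite -addr_eq0 -mulr2n mulrn_eq0 /= => /eqP.
rewrite {1}/S (reindex_inj (addIr c^-1)) /= -sumrN.
apply: eq_bigr => x _.
by rewrite mulrDr mulfV // DD omegaD D1 omega2 mulrN1.
Qed.

Lemma sum_omegaZ (t : 'Z_4) : \sum_u omega (t * u) = if t == 0 then 4 else 0.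
Proof.
have R : \sum_u re4 (t * u) = if t == 0 then 4 else 0.
  by elim/Z4_ind: t; rewrite !big_ord_recl big_ord0.
have I : \sum_u im4 (t * u) = 0.
  by clear R; elim/Z4_ind: t; rewrite !big_ord_recl big_ord0.
under eq_bigr do rewrite omega_ri.
rewrite big_split -mulr_sumr -!(raddf_sum intr) /= R I mulr0 addr0.
by case: ifP.
Qed.

(* The quadruple (u, a, b, c) encodes the codeword
   c(u, [a] + 2[sqrt b], [c]) : x |-> u + Q (a x) + D (b x^2 + c x^3),
   where [ ] is the Teichmuller lift; the square root disappears because
   D (sqrt b * x) = D (b x^2). Since [a] + [a'] = [a + a'] + 2[sqrt (a a')],
   the group law of DG becomes addp. *)
Definition par := ('Z_4 * F * F * F)%type.
Definition par0 : par := (0, 0, 0, 0).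

Definition addp (s p : par) : par :=
  let: (t, A, B, C) := s in let: (u, a, b, c) := p in
  (t + u, A + a, B + b + A * a, C + c).
(** In R, -([A] + 2[sqrt B]) = [A] + 2[sqrt B + A], and sqrt B + A has square B + A^2. *)
Definition oppp (s : par) : par :=
  let: (t, A, B, C) := s in (- t, A, B + A ^+ 2, C).
(** On the R-components this is T(zw) for z = [A] + 2[sqrt B] and w = [a] + 2[sqrt b]; the squares
    arise from D (sqrt B * a) = D (B * a^2). *)
Definition pairing (s p : par) : 'Z_4 :=
  let: (t, A, B, C) := s in let: (u, a, b, c) := p in
  t * u + Q (A * a) + D (B * a ^+ 2 + A ^+ 2 * b + C * c).
Definition chi s p := omega (pairing s p).

Lemma pairingC s p : pairing s p = pairing p s.
Proof.
case: s p => [[[t A] B] C] [[[u a] b] c] /=; congr (_ + _ + D _).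
- by rewrite mulrC.
- by rewrite mulrC.
- ring.
Qed.

Lemma pairingDl s s' p : pairing (addp s s') p = pairing s p + pairing s' p.
Proof.
case: s s' p => [[[t A] B] C] [[[t' A'] B'] C'] [[[u a] b] c] /=.
rewrite !mulrDl QD Q2.
rewrite (_ : B * _ + _ + _ + _ + _ = (A * a * (A' * a)) + ((B * a^+2 + A ^+ 2 * b + C * c) +
  (B' * a^+2 + A' ^+ 2 * b + C' * c))); last by rewrite sqrD; ring.
rewrite 2!DD; move: (Dxx (A * a * (A' * a))).
move: (D _) (D _) (D _) => x y z xx.
by rewrite -[LHS]subr0 -xx; ring.
Qed.

Lemma pairingDr s p p' : pairing s (addp p p') = pairing s p + pairing s p'.
Proof. by rewrite pairingC pairingDl !(pairingC s). Qed.

Lemma pairing0l p : pairing par0 p = 0.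
Proof. by case: p => [[[u a] b] c] /=; rewrite (expr2 0) !mul0r Q0 !addr0 add0r D0. Qed.

Lemma addpN s : addp s (oppp s) = par0.
Proof.
case: s => [[[t A] B] C] /=; rewrite subrr !addxx /par0.
by congr (_, _, _, _); ring2.
Qed.

Lemma addpC s p : addp s p = addp p s.
Proof.
case: s p => [[[t A] B] C] [[[u a] b] c] /=.
by rewrite addrC (addrC A) (addrC B) (mulrC A) (addrC C).
Qed.

Lemma addpA s p r : addp s (addp p r) = addp (addp s p) r.
Proof.
case: s p r => [[[t A] B] C] [[[u a] b] c] [[[v x] y] z] /=.
by rewrite !addrA; congr (_, _, _, _); ring.
Qed.

Lemma addp0 s : addp s par0 = s.
Proof. by case: s => [[[t A] B] C] /=; rewrite mulr0 !addr0. Qed.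

Lemma opppK s : oppp (oppp s) = s.
Proof.
case: s => [[[t A] B] C] /=; rewrite opprK.
by rewrite -addrA addxx addr0.
Qed.

Lemma pairingNl s p : pairing (oppp s) p = - pairing s p.
Proof.
apply/eqP; rewrite -subr_eq0 opprK addrC -pairingDl addpN.
by rewrite pairing0l.
Qed.

Lemma chiDl s s' p : chi (addp s s') p = chi s p * chi s' p.
Proof. by rewrite /chi pairingDl omegaD. Qed.
Lemma chiDr s p p' : chi s (addp p p') = chi s p * chi s p'.
Proof. by rewrite /chi pairingDr omegaD. Qed.
Lemma chiC s p : chi s p = chi p s. Proof. by rewrite /chi pairingC. Qed.
Lemma chi0 p : chi par0 p = 1. Proof. by rewrite /chi pairing0l omega0. Qed.
Lemma chiN s p : chi (oppp s) p = (chi s p)^*.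
Proof. by rewrite /chi pairingNl omega_conj. Qed.

Lemma sum_par (V : nmodType) (f : par -> V) :
  \sum_p f p = \sum_u \sum_a \sum_b \sum_c f (u, a, b, c).
Proof.
under [RHS]eq_bigr => u _ do under eq_bigr => a _ do rewrite pair_bigA /=.
under [RHS]eq_bigr => u _ do rewrite pair_bigA /=.
rewrite pair_bigA /=.
rewrite (reindex (fun p : 'Z_4 * (F * (F * F)) => (p.1, p.2.1, p.2.2.1, p.2.2.2))) //=.
exists (fun p : par => (p.1.1.1, (p.1.1.2, (p.1.2, p.2)))).
  by case=> [u [a [b c]]].
by case=> [[[u a] b] c].
Qed.

Lemma card_par : #|{: par}| = (4 * #|F| ^ 3)%N.
Proof. by rewrite !card_prod card_ord -!mulnA. Qed.

Definition q : algC := #|F|%:R.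

(** The sum over b vanishes unless A = 0; this removes Q from the sum over a, which becomes a linear
    character sum in a^2. *)
Lemma sum_chi s : \sum_p chi s p = if s == par0 then 4 * q ^+ 3 else 0.
Proof.
case: s => [[[t A] B] C]; rewrite sum_par /chi /=.
have -> : \sum_u \sum_a \sum_b \sum_c omega (t * u + Q (A * a) +
     D (B * a ^+ 2 + A ^+ 2 * b + C * c)) = (\sum_u omega (t * u)) *
   ((\sum_a omega (Q (A * a) + D (B * a ^+ 2))) *
   ((\sum_b omega (D (A ^+ 2 * b))) * (\sum_c omega (D (C * c))))).
  rewrite mulr_suml; apply: eq_bigr => u _.
  rewrite mulr_suml mulr_sumr; apply: eq_bigr => a _.
  rewrite mulr_suml !mulr_sumr; apply: eq_bigr => b _.
  rewrite !mulr_sumr; apply: eq_bigr => c _.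
  by rewrite !DD !omegaD !mulrA.
rewrite !sum_omegaD sum_omegaZ sqrf_eq0 -/q /par0 !xpair_eqE.
case: eqP => _; last by rewrite mul0r.
case: eqP => [->|_]; last by rewrite /= mul0r !mulr0.
case: (eqVneq C 0) => _; last by rewrite !andbF !mulr0.
under eq_bigr do rewrite mul0r Q0 add0r.
rewrite (sum_sqr (fun a => omega (D (B * a)))) sum_omegaD; by case: eqP => _ /=; rewrite -/q ?mul0r ?mulr0 //; ring.
Qed.

(* The evaluation of the codeword p at x is the value at p of the character of
   label (1, x, 0, x^3). *)
Definition phase p := \sum_x chi (1, x, 0, x ^+ 3) p.
Definition lam p : int := \sum_x re4 (pairing (1, x, 0, x ^+ 3) p).
Definition lamI p : int := \sum_x im4 (pairing (1, x, 0, x ^+ 3) p).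

Lemma phaseE p : phase p = (lam p)%:~R + 'i * (lamI p)%:~R.
Proof.
rewrite /lam /lamI !(raddf_sum intr) mulr_sumr -big_split /=.
by apply: eq_bigr => x _; rewrite /chi omega_ri.
Qed.

Lemma phaseNE p : (phase p)^* = (lam p)%:~R - 'i * (lamI p)%:~R.
Proof.
by rewrite phaseE rmorphD rmorphM !rmorph_int /= conjCi mulNr.
Qed.


Definition ev (a b c y : F) := Q (y * a) + D (y ^+ 2 * b + y ^+ 3 * c).
Definition radp (a c y : F) := c * y + (y ^+ 2 * c + a ^+ 2 * y) ^+ 2.
(* rad a c is the radical of the bilinear form attached to the Z_4-valued
   quadratic form x |-> Q (a x) + D (c x^3). *)
Definition rad a c : {set F} := [set y | radp a c y == 0].

Lemma evE u a b c y : pairing (1, y, 0, y ^+ 3) (u, a, b, c) = u + ev a b c y.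
Proof. by rewrite /= mul1r mul0r add0r -addrA. Qed.

(** The polar form: the cubic term contributes D (c y x^2 + c y^2 x) and Q contributes D (a^2 x y).
    The terms linear in x are squared under D, so that a single coefficient of x^2 remains. *)
Lemma evD a b c x y :
  ev a b c (x + y) = ev a b c x + (ev a b c y + D (radp a c y * x ^+ 2)).
Proof.
rewrite /ev mulrDl QD Q2.
have -> : D (radp a c y * x ^+ 2) = D (c * y * x ^+ 2) + D (x * (y ^+ 2 * c + a ^+ 2 * y)).
  by rewrite -[in RHS](Dsqr (x * _)) -DD; congr D; rewrite /radp; ring.
have -> : (x + y) ^+ 2 * b + (x + y) ^+ 3 * c = (x ^+ 2 * b + x ^+ 3 * c) +
  (y ^+ 2 * b + y ^+ 3 * c) + (c * y * x ^+ 2 + x * (y ^+ 2 * c)) by ring2.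
have -> : x * a * (y * a) = x * (a ^+ 2 * y) by ring.
by rewrite mulrDr !DD; ring.
Qed.

(** Expand the squared modulus over pairs x, x + y. For fixed y the sum over x is that of a linear
    character in x^2 with coefficient [radp a c y], nonzero only for y in the radical. *)
Lemma phase_norm u a b c :
  phase (u, a, b, c) * (phase (u, a, b, c))^* = q * \sum_(y in rad a c) omega (ev a b c y).
Proof.
transitivity (\sum_x \sum_y chi (1, x + y, 0, (x + y) ^+ 3) (u, a, b, c) *
    (chi (1, x, 0, x ^+ 3) (u, a, b, c))^*).
  rewrite /phase rmorph_sum /= mulr_sumr; apply: eq_bigr => x _.
  by rewrite (reindex_inj (addrI x)) /= mulr_suml.
rewrite exchange_big /= mulr_sumr [RHS]big_mkcond /=; apply: eq_bigr => y _.
have E x : chi (1, x + y, 0, (x + y) ^+ 3) (u, a, b, c) * (chi (1, x, 0, x ^+ 3) (u, a, b, c))^*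
  = omega (ev a b c y) * omega (D (radp a c y * x ^+ 2)).
  rewrite /chi !evE omega_conj -!omegaD evD; congr omega; ring.
under eq_bigr do rewrite E.
rewrite -mulr_sumr (sum_sqr (fun z => omega (D (radp a c y * z)))) sum_omegaD inE.
by case: ifP; rewrite ?mulr0 // mulrC.
Qed.

Lemma rad0 a c : 0 \in rad a c.
Proof. by rewrite inE /radp; apply/eqP; ring. Qed.

Lemma radD a c x y : x \in rad a c -> y \in rad a c -> x + y \in rad a c.
Proof.
rewrite !inE => /eqP hx /eqP hy; rewrite -[0]addr0 -{1}hx -hy; apply/eqP.
rewrite /radp; ring2.
Qed.

Lemma card_rad_dvd a c : (#|rad a c| %| 2 ^ m)%N.
Proof.
have gr : group_set (rad a c).
  by apply/group_setP; split=> [|x y]; [exact: rad0 | exact: radD].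
by rewrite -cardF -cardsT; have := cardSg (subsetT (Group gr)).
Qed.

(** The radical is an additive group, hence of order a power of 2, and its elements are the roots of
    a nonzero linearised polynomial of degree at most 4. *)
Lemma card_rad a c : (a, c) != (0, 0) -> exists2 k, (k <= 2)%N & #|rad a c| = (2 ^ k)%N.
Proof.
move=> ac0; have /(dvdn_pfactor _ _ (isT : prime 2)) [k _ E] := card_rad_dvd a c.
exists k => //; rewrite -(leq_exp2l _ _ (isT : 1 < 2)%N) -E.
pose P : {poly F} := (c ^+ 2) *: 'X^4 + (a ^+ 4) *: 'X^2 + c *: 'X.
have P0 : P != 0.
  apply: contra ac0 => /eqP P0.
  have: P`_4 == 0 by rewrite P0 coef0.
  have: P`_2 == 0 by rewrite P0 coef0.
  rewrite !coefD !coefZ !coefXn !coefX /= !mulr0 !mulr1 !addr0 !add0r !expf_eq0 /=.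
  by move=> /eqP -> /eqP ->.
have sP : (size P <= 5)%N.
  rewrite /P !(leq_trans (size_polyD _ _)) // geq_max.
  rewrite (leq_trans (size_polyD _ _)) ?geq_max ?(leq_trans (size_scale_leq _ _)) ?size_polyXn //.
  by rewrite size_polyX.
rewrite cardE -ltnS (leq_trans _ sP) //; apply: max_poly_roots => //; last exact: enum_uniq.
apply/allP => y; rewrite mem_enum inE => /eqP h; apply/eqP.
rewrite -h /P /radp !hornerD !hornerZ !hornerXn hornerX; ring2.
Qed.

(** The polar form vanishes on the radical, so [omega (ev a b c y)] is a character of that group; a
    nontrivial one needs a nontrivial group. *)
Lemma sum_rad a b c : \sum_(y in rad a c) omega (ev a b c y) = #|rad a c|%:R \/
   #|rad a c| != 1%N /\ \sum_(y in rad a c) omega (ev a b c y) = 0.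
Proof.
set S := \sum_(y in _) _.
case: (boolP [forall y in rad a c, omega (ev a b c y) == 1]) => [/forall_inP h|].
  left; rewrite -sum1_card natr_sum; apply: eq_bigr => y /h /eqP -> //.
case/forall_inPn => z hz nz; right; split.
  apply: contra nz => /cards1P [z0 e]; move: hz (rad0 a c).
  rewrite e !inE => /eqP -> /eqP <-.
  by rewrite /ev (expr2 0) exprS !mul0r Q0 !addr0 add0r D0 omega0.
have E : S = omega (ev a b c z) * S.
  rewrite {1}/S (reindex_inj (addIr z)) /= mulr_sumr; apply: eq_big => y.
    apply/idP/idP => hy; last exact: radD.
    by rewrite -[y]addr0 -(addxx z) addrA radD.
  move=> _; rewrite evD omegaD mulrC omegaD.
  by move: hz; rewrite inE => /eqP ->; rewrite mul0r D0 omega0 mulr1.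
by move/eqP: E; rewrite -subr_eq0 -{1}[S]mul1r -mulrBl mulf_eq0 subr_eq0 eq_sym (negPf nz) => /eqP.
Qed.

(* h = sqrt (q / 2) and rt = sqrt (2 q) are integers because m is odd. *)
Definition h : int := (2 ^ m./2)%N%:Z.

Lemma q_hN : (2 ^ m)%N%:Z = 2 * h ^+ 2.
Proof.
by rewrite -{1}(odd_double_half m) m_odd /h expnD -muln2 expnM PoszM -mulnn PoszM -expr2.
Qed.

Lemma q_h : q = (2 * h ^+ 2)%:~R.
Proof. by rewrite /q cardF -q_hN. Qed.

Lemma lamN p : lam (oppp p) = lam p.
Proof.
by apply: eq_bigr => x _; rewrite pairingC pairingNl re4N pairingC.
Qed.

Lemma lam_norm p : phase p * (phase p)^* = (lam p ^+ 2 + lamI p ^+ 2)%:~R.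
Proof.
rewrite phaseNE phaseE rmorphD !rmorphXn /=.
transitivity ((lam p)%:~R ^+ 2 - 'i ^+ 2 * (lamI p)%:~R ^+ 2 : algC); first ring.
by rewrite sqrCi mulN1r opprK.
Qed.

(** If the radical has order 2^k, then lam^2 + lamI^2 is 0 or 2^(k+1) h^2. For k = 0, 1, 2 the
    latter is 2 * 4^j, 4^(j+1), 2 * 4^(j+1) with j = [m./2], and the lemmas on sums of two squares
    apply. *)
Lemma lam_rad u a b c : (a, c) != (0, 0) ->
  if #|rad a c| == 1%N then lam (u, a, b, c) ^+ 2 = h ^+ 2
  else lam (u, a, b, c) = 0 \/ lam (u, a, b, c) ^+ 2 = (2 * h) ^+ 2.
Proof.
move=> ac0; have [k k2 E] := card_rad ac0.
have := lam_norm (u, a, b, c); rewrite phase_norm; move: (lam _) (lamI _) => x y.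
have sqE (z : int) : z ^+ 2 = (`|z| * `|z|)%N.
  by rewrite -abszM abszE -expr2 ger0_norm // sqr_ge0.
have hE : h ^+ 2 = (4 ^ m./2)%N by rewrite sqE /h absz_nat -expnMn.
have h2E : (2 * h) ^+ 2 = (4 ^ (m./2).+1)%N by rewrite exprMn hE expnS PoszM.
rewrite hE h2E !sqE; have := sum_rad a b c; rewrite E.
case=> [|[ne1]] ->.
  rewrite q_h -[(2 ^ k)%:R]/((2 ^ k)%N%:Z%:~R) -rmorphM => /eqP; rewrite eqr_int hE => /eqP.
  rewrite -!PoszM -PoszD => -[].
  case: k k2 {E} => [|[|[|//]]] _ e /=.
  - by congr Posz; apply: (@sumsq_2pow4 _ _ `|y|%N); rewrite -e; lia.
  - have [|z|z] := @sumsq_pow4 (m./2).+1 `|x|%N `|y|%N; first by rewrite -e expnS; lia.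
      by left; apply/eqP; rewrite -absz_eq0 z.
    by right; rewrite z.
  - right; congr Posz.
    by apply: (@sumsq_2pow4 _ _ `|y|%N); rewrite -e expnS; lia.
rewrite mulr0 (negPf ne1) => /eqP; rewrite eq_sym intr_eq0 -PoszD => /eqP -[] e; left.
by apply/eqP; rewrite -absz_eq0; apply/eqP; nia.
Qed.

Lemma lam2 p : (2 * lam p)%:~R = phase p + (phase p)^*.
Proof. by rewrite phaseNE phaseE rmorphM /=; ring. Qed.

Lemma lam_lin u b : lam (u, 0, b, 0) = if b == 0 then re4 u * (2 * h ^+ 2) else 0.
Proof.
have E : phase (u, 0, b, 0) = if b == 0 then omega u * q else 0.
  rewrite /phase.
  under eq_bigr => x _ do rewrite /chi evE /ev !mulr0 Q0 add0r addr0 omegaD mulrC.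
  rewrite -mulr_suml (sum_sqr (fun z => omega (D (z * b)))).
  under eq_bigr => x _ do rewrite mulrC.
  by rewrite sum_omegaD; case: ifP => _; rewrite ?mul0r // mulrC.
apply: (@mulfI _ (2 : int)) => //; apply: (@intr_inj algC); rewrite lam2 E.
case: ifP => _; last by rewrite rmorph0 addr0.
rewrite (rmorphM Num.conj) (rmorph_nat Num.conj) -/q /= omega_conj omegaN omega_ri.
by rewrite q_h; move: (2 * h ^+ 2) => w; rewrite !(rmorphM intr) /=; ring.
Qed.

(** * The eight classes of codewords and their symmetries *)

Definition lval (j : 'I_8) : int :=
  nth 0 [:: 2 * h ^+ 2; 2 * h; h; 0; 0; - h; - (2 * h); - (2 * h ^+ 2)] j.

(** The flag [k] records membership in the Kerdock code, which separates the two classes with lam =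
    0. *)
Definition cls_of (l : int) (k : bool) : 'I_8 :=
  if l == 2 * h ^+ 2 then 0 else if l == 2 * h then 1 else if l == h then 2
  else if l == 0 then (if k then 3 else 4) else if l == - h then 5
  else if l == - (2 * h) then 6 else 7.

Definition cls (p : par) : 'I_8 := cls_of (lam p) (p.2 == 0).

(** This keeps 2 h and 2 h^2 apart in the list of values of lam. *)
Lemma h_ge2 : 2 <= h.
Proof.
rewrite /h lez_nat -[X in (X <= _)%N]/(2 ^ 1)%N leq_exp2l //.
by move: m_odd m_gt1; lia.
Qed.

Lemma re4_val (z : 'Z_4) : [\/ re4 z = 1, re4 z = 0 | re4 z = -1].
Proof.
elim/Z4_ind: z; [by apply: Or31 | by apply: Or32 | by apply: Or33 | by apply: Or32].
Qed.

Lemma lam_cls p : lam p = lval (cls p).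
Proof.
suff H : lam p \in [:: 2 * h ^+ 2; 2 * h; h; 0; - h; - (2 * h); - (2 * h ^+ 2)].
  rewrite /cls; move: H (p.2 == 0) => + k; rewrite /cls_of !inE.
  do 6?[case: eqP => [->|_]; first by case: k].
  by move=> /= /eqP ->.
case: p => [[[u a] b] c]; case: (eqVneq (a, c) (0, 0)) => [[-> ->]|].
  rewrite lam_lin; case: ifP => _; last by rewrite !inE eqxx !orbT.
  by case: (re4_val u) => ->; rewrite ?mul1r ?mul0r ?mulN1r !inE eqxx ?orbT.
move/(@lam_rad u a b c); case: ifP => _; rewrite !inE.
  by move/eqP; rewrite eqf_sqr => /orP [] ->; rewrite ?orbT.
case=> [->|]; first by rewrite eqxx !orbT.
by move/eqP; rewrite eqf_sqr => /orP [] ->; rewrite ?orbT.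
Qed.

Lemma cls_of_lval k : [/\ cls_of (2 * h ^+ 2) k = 0, cls_of (2 * h) k = 1,
  cls_of h k = 2, cls_of 0 k = if k then 3 else 4
  & [/\ cls_of (- h) k = 5, cls_of (- (2 * h)) k = 6 & cls_of (- (2 * h ^+ 2)) k = 7]].
Proof.
have h2 := h_ge2; have hh : 2 * h <= h ^+ 2 by rewrite expr2 ler_wpM2r //; lia.
move: hh; set x := h ^+ 2 => hh; rewrite /cls_of; do 2?split.
all: by repeat (case: eqP => ? //; try by exfalso; lia).
Qed.

Lemma cls_lin u b : cls (u, 0, b, 0) =
  if b == 0 then (if u == 0 then 0 else if u == 2 then 7 else 3) else 3.
Proof.
have [c0 _ _ c3 [_ _ c7]] := cls_of_lval true.
rewrite /cls lam_lin eqxx; case: ifP => _ //.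
by elim/Z4_ind: u => /=; rewrite ?mul1r ?mul0r ?mulN1r.
Qed.

Lemma rad_c0 a : a != 0 -> rad a 0 = [set 0].
Proof.
move=> a0; apply/setP => y; rewrite !inE /radp !(mul0r, mulr0, add0r).
by rewrite !(expf_eq0, mulf_eq0) /= (negPf a0).
Qed.

Lemma cls_nlin u a b c : (a, c) != (0, 0) ->
  if #|rad a c| == 1%N then cls (u, a, b, c) \in [:: 2; 5]
  else cls (u, a, b, c) \in [:: 1; 4; 6].
Proof.
move=> ac; have [_ c1 c2 c3 [c5 c6 _]] := cls_of_lval (c == 0).
have := lam_rad u b ac; rewrite /cls /=; case: ifP => [r1|r1].
  by move/eqP; rewrite eqf_sqr => /orP [] /eqP ->; rewrite ?c2 ?c5.
case=> [l0|].
  (* For c = 0 the radical would be trivial, so here lam = 0 forces the word out of the Kerdock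
     code. *)
  have c0 : c != 0.
    apply: contraFN r1 => /eqP c0; move: ac.
    by rewrite c0 xpair_eqE eqxx andbT => a0; rewrite rad_c0 // cards1.
  by rewrite l0 c3 (negPf c0).
by move/eqP; rewrite eqf_sqr => /orP [] /eqP ->; rewrite ?c1 ?c6.
Qed.

Lemma cls03 u a b c :
  (cls (u, a, b, c) \in [:: 0; 3; 7 : 'I_8]) = (a == 0) && (c == 0).
Proof.
rewrite (_ : (a == 0) && (c == 0) = ((a, c) == (0, 0))); last by rewrite xpair_eqE.
case: (eqVneq (a, c) (0, 0)) => [[-> ->]|ac].
  by rewrite cls_lin; do 3?case: ifP.
have := cls_nlin u b ac; case: ifP => _; rewrite !inE.
  by case/orP => /eqP ->.
by case/or3P => /eqP ->.
Qed.

Lemma cls25 u a b c :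
  (cls (u, a, b, c) \in [:: 2; 5 : 'I_8]) = (#|rad a c| == 1%N).
Proof.
case: (eqVneq (a, c) (0, 0)) => [[-> ->]|ac].
  have -> : rad 0 0 = [set: F].
    by apply/setP => y; rewrite !inE /radp; apply/eqP; ring.
  rewrite cardsT cardF cls_lin (_ : (2 ^ m == 1)%N = false); first by do 3?case: ifP.
  by rewrite -[1%N]/(2 ^ 0)%N eqn_exp2l //; case: (m) m_gt1.
have := cls_nlin u b ac; case: ifP => _ //; rewrite !inE.
by case/or3P => /eqP ->.
Qed.

Definition esum s j : algC := \sum_(p | cls p == j) chi s p.

Lemma sum_cls (s : par) (g : 'I_8 -> algC) :
  \sum_p chi s p * g (cls p) = \sum_j g j * esum s j.
Proof.
rewrite (partition_big cls xpredT) //=; apply: eq_bigr => j _.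
by rewrite mulr_sumr; apply: eq_bigr => p /eqP ->; rewrite mulrC.
Qed.

Lemma momE s k :
  \sum_p chi s p * (phase p + (phase p)^*) ^+ k =
  \sum_j (2 * lval j)%:~R ^+ k * esum s j.
Proof.
by rewrite -sum_cls; apply: eq_bigr => p _; rewrite -lam2 lam_cls.
Qed.

Lemma re4D2 z : re4 (z + 2) = - re4 z. Proof. by elim/Z4_ind: z. Qed.

(** The permutation of the classes induced by adding the constant word 2, which negates lam. *)
Definition opp8 (j : 'I_8) : 'I_8 := nth 0 [:: 7; 6; 5; 3; 4; 2; 1; 0] j.

Lemma cls_ofN l k : l \in [:: 2 * h ^+ 2; 2 * h; h; 0; - h; - (2 * h); - (2 * h ^+ 2)] ->
  cls_of (- l) k = opp8 (cls_of l k).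
Proof.
have [c0 c1 c2 c3 [c5 c6 c7]] := cls_of_lval k.
rewrite !inE => /or4P [|||/or4P []] => /eqP ->;
  by rewrite ?opprK ?oppr0 ?(c0, c1, c2, c3, c5, c6, c7) //; case: (k).
Qed.

Lemma pairing_two s : pairing s (2, 0, 0, 0) = s.1.1.1 *+ 2.
Proof.
by case: s => [[[t A] B] C] /=; rewrite (expr2 0) !mulr0 Q0 !addr0 D0 addr0 mulr_natr.
Qed.

Lemma cls2 p : cls (addp p (2, 0, 0, 0)) = opp8 (cls p).
Proof.
have -> : cls (addp p (2, 0, 0, 0)) = cls_of (- lam p) (p.2 == 0).
  rewrite /cls; congr cls_of; last first.
    by case: p => [[[u a] b] c] /=; rewrite addr0.
  rewrite /lam -sumrN; apply: eq_bigr => x _.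
  by rewrite pairingDr pairing_two re4D2.
rewrite cls_ofN // lam_cls.
by case: (cls p) => [[|[|[|[|[|[|[|[|]]]]]]]]] //= i; rewrite !inE eqxx ?orbT.
Qed.

Lemma esumN s j : esum (oppp s) j = esum s j.
Proof.
rewrite /esum (reindex_inj (can_inj opppK)) /=.
apply: eq_big => [p|p _]; first by rewrite /cls lamN; case: p => [[[]]].
by rewrite /chi pairingNl pairingC pairingNl pairingC opprK.
Qed.

Lemma addp_inj r : injective (fun p => addp p r).
Proof.
move=> p p' /= e.
by rewrite -[p]addp0 -[p']addp0 -(addpN r) !addpA e.
Qed.

Lemma opp8K : involutive opp8.
Proof. by case=> [[|[|[|[|[|[|[|[|]]]]]]]]] //= i; apply/val_inj. Qed.

Lemma esum_opp s j : esum s (opp8 j) = omega (s.1.1.1 *+ 2) * esum s j.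
Proof.
rewrite /esum (reindex_inj (@addp_inj (2, 0, 0, 0))) /= mulr_sumr.
apply: eq_big => [p|p _]; first by rewrite cls2 (can_eq opp8K).
rewrite chiDr mulrC; congr (_ * _); case: s => [[[t A] B] C].
by rewrite /chi pairing_two.
Qed.

(** A condition on (a, c) alone leaves u and b free, so their sums split off as full character
    sums. *)
Lemma sum_chi_ac (P : F -> F -> bool) t A B C :
  \sum_p (if P p.1.1.2 p.2 then chi (t, A, B, C) p else 0) =
  (\sum_u omega (t * u)) * ((\sum_b omega (D (A ^+ 2 * b))) *
  \sum_a \sum_c if P a c then omega (Q (A * a) + D (B * a ^+ 2 + C * c)) else 0).
Proof.
rewrite sum_par mulr_suml; apply: eq_bigr => u _.
under eq_bigr do rewrite exchange_big.
rewrite mulrCA mulr_sumr mulr_sumr; apply: eq_bigr => a _ /=.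
rewrite !mulr_sumr; apply: eq_bigr => c _.
case: ifP => _; last by rewrite !mulr0 big1.
rewrite mulrC mulr_sumr; apply: eq_bigr => b _.
rewrite /chi /= -!omegaD; congr omega; rewrite !DD; ring.
Qed.

Lemma sum_chi_ac0 (P : F -> F -> bool) t A B C : (t, A) != (0, 0) ->
  \sum_p (if P p.1.1.2 p.2 then chi (t, A, B, C) p else 0) = 0.
Proof.
rewrite sum_chi_ac sum_omegaZ sum_omegaD sqrf_eq0 xpair_eqE.
by case: (t == 0) => /= h; rewrite ?mul0r // (negPf h) mul0r mulr0.
Qed.

Lemma esum25 t A B C : (t, A) != (0, 0) ->
  esum (t, A, B, C) 2 + esum (t, A, B, C) 5 = 0.
Proof.
move=> tA; rewrite -(sum_chi_ac0 (fun a c => #|rad a c| == 1%N) B C tA) /esum.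
rewrite big_mkcond [X in _ + X]big_mkcond -big_split /=; apply: eq_bigr => -[[[u a] b] c] _ /=.
have := cls25 u a b c; rewrite !inE => <-.
by move: (cls _) => k; case: (eqVneq k 2) => [->|_] /=; rewrite ?addr0 ?add0r.
Qed.

(** Classes 0, 3 and 7 together form the subgroup a = c = 0, of order 4 q. *)
Lemma esum037 t A B C : esum (t, A, B, C) 0 + esum (t, A, B, C) 3 + esum (t, A, B, C) 7 =
  if (t, A) == (0, 0) then 4 * q else 0.
Proof.
transitivity (\sum_p (if (p.1.1.2 == 0) && (p.2 == 0) then chi (t, A, B, C) p else 0)).
  rewrite /esum big_mkcond [X in _ + X + _]big_mkcond [X in _ + X]big_mkcond -!big_split /=.
  apply: eq_bigr => -[[[u a] b] c] _ /=.
  have := cls03 u a b c; rewrite !inE => <-.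
  move: (cls _) => k; case: (eqVneq k 0) => [->|_] /=; first by rewrite !addr0.
  by case: (eqVneq k 3) => [->|_] /=; rewrite ?addr0 ?add0r.
case: ifP => [|/negbT]; last exact: (@sum_chi_ac0 (fun a c => (a == 0) && (c == 0))).
rewrite xpair_eqE => /andP [/eqP -> /eqP ->].
rewrite (sum_chi_ac (fun a c => (a == 0) && (c == 0))) sum_omegaZ sum_omegaD eqxx expr0n eqxx /=.
rewrite (bigD1 0) //= [X in _ + X]big1 ?addr0; last first.
  by move=> a /negPf ->; rewrite big1.
rewrite (bigD1 0) //= [X in _ + X]big1 ?addr0; last first.
  by move=> a /negPf ->; rewrite andbF.
by rewrite eqxx /= !mulr0 expr0n /= mulr0 Q0 addr0 add0r D0 omega0 mulr1.
Qed.

Lemma cls_eq0 p : (cls p == 0) = (p == par0).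
Proof.
case: p => [[[u a] b] c].
have := cls03 u a b c; rewrite !inE => E.
case: (eqVneq a 0) E => [->|a0] /=; last first.
  by case: eqP => // _ _; rewrite /par0 !xpair_eqE (negPf a0) !andbF.
case: (eqVneq c 0) => [->|c0] /=; last first.
  by case: eqP => // _ _; rewrite /par0 !xpair_eqE (negPf c0) !andbF.
move=> _; rewrite cls_lin /par0 !xpair_eqE !eqxx !andbT.
by case: (b == 0); case: (u == 0); case: (u == 2).
Qed.

Lemma esum0 s : esum s 0 = 1.
Proof. by rewrite /esum (eq_bigl _ _ cls_eq0) big_pred1_eq chiC chi0. Qed.

Lemma esum7 s : esum s 7 = omega (s.1.1.1 *+ 2).
Proof. by rewrite -[7]/(opp8 0) esum_opp esum0 mulr1. Qed.

(** * Counting four-point configurations with a given syndrome *)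

Lemma sqr_surj (d : F) : exists e, d = e ^+ 2.
Proof. by exists (invF sqr_inj d); exact: esym (f_invF sqr_inj d). Qed.

Lemma Dsqr_add t : D (t ^+ 2 + t) = 0.
Proof. by rewrite DD Dsqr Dxx. Qed.

(** With r = z / y the equation reads r^2 + r = 1, whose two sides have traces 0 and 1: F has no
    primitive cube root of unity. *)
Lemma no_cubic_root (y z : F) : y ^+ 2 + y * z + z ^+ 2 = 0 -> y = 0.
Proof.
case: (eqVneq y 0) => // y0 e; exfalso.
have : (z / y) ^+ 2 + z / y = (y ^+ 2 + y * z + z ^+ 2) / y ^+ 2 - 1 by field.
rewrite e mul0r sub0r oppN1 => /(congr1 D).
by rewrite Dsqr_add D1.
Qed.

(* Up to translation, KA and KB are the sets of four points with sum 0 and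
   prescribed syndrome (d, e), for the sign patterns ++++ and ++--. *)
Definition KA d e : {set F * F} :=
  [set p | (p.1 ^+ 2 + p.1 * p.2 + p.2 ^+ 2 == d) && (p.1 * p.2 * (p.1 + p.2) == e)].
Definition KB d e : {set F * F} :=
  [set p | (p.1 * p.2 == d) && (p.1 * p.2 * (p.1 + p.2) == e)].
(** The weights come from the binomial expansions: 1 and 3 in the third moment, 2 and 6 in the
    fourth. *)
Definition K d e : nat := (#|KA d e| + 3 * #|KB d e|)%N.

Lemma card_seq (T : finType) (A : {set T}) (s : seq T) : A =i s -> uniq s -> #|A| = size s.
Proof. by move=> e /card_uniqP <-; apply: eq_card. Qed.

Lemma KA_e0 d : KA (d ^+ 2) 0 =i [:: (0, d); (d, 0); (d, d)].
Proof.
move=> [y z]; rewrite !inE /= !xpair_eqE !mulf_eq0.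
case: (eqVneq y 0) => [->|y0] /=.
  rewrite mul0r expr0n /= !add0r (inj_eq sqr_inj) andbT.
  case: (eqVneq z d) => //= zd; rewrite !andbF orbF; apply/esym/negP => /andP [/eqP e1 /eqP e2].
  by rewrite -e1 e2 eqxx in zd.
case: (eqVneq z 0) => [->|z0] /=.
  rewrite mulr0 expr0n /= !addr0 (inj_eq sqr_inj).
  by case: (eqVneq y d).
rewrite andbF addx_eq0 /=.
case: (eqVneq y z) => [<-|yz]; rewrite ?andbF ?andbT; last first.
  by apply/esym/negP => /andP [/eqP e /eqP e']; rewrite e e' eqxx in yz.
rewrite andbb -[in RHS](inj_eq sqr_inj); congr (_ == _); ring2.
Qed.

Lemma KB_e0 d : d != 0 -> KB (d ^+ 2) 0 =i [:: (d, d)].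
Proof.
move=> d0 [y z]; rewrite !inE /= !xpair_eqE.
apply/andP/andP => [[/eqP e]|[/eqP -> /eqP ->]]; last by rewrite expr2 addxx mulr0 !eqxx.
rewrite e mulf_eq0 sqrf_eq0 (negPf d0) /= addx_eq0 => /eqP yz; move: e.
by rewrite -yz -expr2 => /sqr_inj ->.
Qed.

Lemma K_E0 d : d != 0 -> K d 0 = 6%N.
Proof.
have [e ->] := sqr_surj d; rewrite sqrf_eq0 => e0.
rewrite /K (card_seq (KA_e0 e)) ?(card_seq (KB_e0 e0)) //=.
by rewrite !inE !xpair_eqE (negPf e0) [0 == e]eq_sym (negPf e0) ?andbF.
Qed.

(** [KA 0 0] is one point and [KB 0 0] is the union of the two axes, so K = 1 + 3 (2q - 1). *)
Lemma K00 : (K 0%R 0%R + 2 = 6 * #|F|)%N.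
Proof.
rewrite /K; have -> : KA 0 0 = [set (0, 0)] :> {set F * F}.
  by apply/setP => p; have := KA_e0 0 p; rewrite expr0n /= => ->; rewrite !inE !orbb.
have -> : KB 0 0 = setX [set 0] [set: F] :|: setX [set: F] [set 0].
  apply/setP => -[y z]; rewrite !inE /= !mulf_eq0.
  by case: (y == 0); case: (z == 0); rewrite ?andbT.
rewrite cards1 cardsU !cardsX !cards1 !cardsT.
have -> : setX [set 0] [set: F] :&: setX [set: F] [set 0] = [set (0, 0)].
  by apply/setP => -[y z]; rewrite !inE /= andbT xpair_eqE.
rewrite cards1 mul1n muln1 !cardF.
have : (0 < 2 ^ m)%N by rewrite expn_gt0.
by move: (2 ^ m)%N => k; lia.
Qed.

(** The product d and the sum e / d are prescribed, so y and z are the two roots of a quadratic,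
    distinct because their sum is nonzero. *)
Lemma KB_cases d e : d != 0 -> e != 0 -> #|KB d e| = 0%N \/ #|KB d e| = 2%N.
Proof.
move=> d0 e0; case: (set_0Vmem (KB d e)) => [->|[[y z]]]; first by left; rewrite cards0.
rewrite !inE /= => /andP [/eqP yz /eqP yze]; right.
rewrite -yze yz in e0; have yz' : y != z.
  by apply: contraNneq e0 => ->; rewrite addxx mulr0.
apply: (@card_seq _ _ [:: (y, z); (z, y)]); last first.
  by rewrite /= inE xpair_eqE (negPf yz').
move=> [y1 z1]; rewrite !inE /= !xpair_eqE -yze -yz.
apply/andP/orP => [[/eqP h1]|[] /andP [/eqP -> /eqP ->]]; last 2 first.
- by rewrite !eqxx.
- by rewrite mulrC addrC !eqxx.
rewrite h1 (inj_eq (mulfI _)) ?yz // => /eqP h2.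
have z1E : z1 = y + z + y1 by rewrite -h2; ring2.
have : (y1 + y) * (y1 + z) = 0.
  by rewrite (_ : _ * _ = y * z + y1 * (y + z + y1)); [rewrite -z1E h1; ring2 | ring2].
move/eqP; rewrite mulf_eq0 !addx_eq0 z1E => /orP [] /eqP ->; [left|right]; rewrite eqxx /=;
  by apply/eqP; ring2.
Qed.

(** A point (y, z) makes y, z, y + z the three roots of X^3 + d X + e, distinct as e is nonzero; the
    solutions are the ordered pairs of distinct roots. *)
Lemma KA_cases d e : e != 0 -> #|KA d e| = 0%N \/ #|KA d e| = 6%N.
Proof.
move=> e0; case: (set_0Vmem (KA d e)) => [->|[[y z]]]; first by left; rewrite cards0.
rewrite !inE /= => /andP [/eqP yz /eqP yze]; right.
move: (e0); rewrite -{1}yze !mulf_eq0 !negb_or addx_eq0 => /andP [/andP [y0 z0] yz'].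
apply: (@card_seq _ _ [:: (y, z); (z, y); (y, y + z); (y + z, y); (z, y + z); (y + z, z)]); last first.
  have zy' : z != y by rewrite eq_sym.
  rewrite /= !inE !xpair_eqE.
  have n1 : (y == y + z) = false by rewrite -addx_eq0 addrA addxx add0r (negPf z0).
  have n2 : (z == y + z) = false by rewrite -addx_eq0 addrCA addxx addr0 (negPf y0).
  by rewrite (negPf yz') (negPf zy') !(eq_sym (y + z)) n1 n2 !eqxx /= ?andbF.
move=> [y1 z1]; rewrite !inE /= !xpair_eqE -yze -yz.
apply/andP/idP => [[/eqP h1 /eqP h2]|]; last first.
  by do 5?[case/orP]; case/andP => /eqP -> /eqP ->; split; apply/eqP; ring2.
have : (y1 + y) * (y1 + z) * (y1 + (y + z)) = 0.
  transitivity (y1 ^+ 3 + (y ^+ 2 + y * z + z ^+ 2) * y1 + y * z * (y + z)); first by ring2.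
  by rewrite -h1 -h2; ring2.
have key (a b : F) : a != 0 -> a * z1 * (a + z1) = a * b * (a + b) -> (z1 == b) || (z1 == a + b).
  move=> a0 h; have : a * (z1 + b) * (z1 + (a + b)) = 0.
    transitivity (a * z1 * (a + z1) + a * b * (a + b)); first by ring2.
    by rewrite h addxx.
  by move/eqP; rewrite !mulf_eq0 (negPf a0) !addx_eq0.
move/eqP; rewrite !mulf_eq0 !addx_eq0 -orbA => /or3P [] /eqP e1; rewrite e1 eqxx /= in h2 *.
- by case/orP: (key _ z y0 h2) => ->; rewrite ?orbT.
- have h3 : z * z1 * (z + z1) = z * y * (z + y) by rewrite h2; ring.
  by case/orP: (key _ y z0 h3) => h; rewrite ?(addrC y z) h ?orbT.
- have w0 : y + z != 0 by rewrite addx_eq0.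
  have h3 : (y + z) * z1 * (y + z + z1) = (y + z) * y * (y + z + y) by rewrite h2; ring2.
  case/orP: (key _ y w0 h3) => h; rewrite ?h ?orbT //.
  by move: h; rewrite addrAC addxx add0r => ->; rewrite !orbT.
Qed.

(* A point of KB makes d^3/e^2 of the form r^2 + r, hence of trace 0, while a
   point of KA makes its trace equal to that of 1, which is 1 as m is odd. *)
Lemma KAB_excl d e : d != 0 -> e != 0 -> KA d e != set0 -> KB d e = set0.
Proof.
move=> d0 e0 /set0Pn [[y z]]; rewrite !inE /= => /andP [/eqP yz /eqP yze].
apply/eqP; rewrite -[_ == _]negbK; apply/negP => /set0Pn [[y' z']].
rewrite !inE /= => /andP [/eqP yz' /eqP yze'].
move: (e0); rewrite -yze !mulf_eq0 !negb_or => /andP [/andP [y0 z0] yz0].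
have yz0' : y' + z' != 0.
  by apply: contraNneq e0 => h; rewrite -yze' h mulr0.
have : D (d ^+ 3 / e ^+ 2) = 0.
  (* The quotient is r (1 - r) with r = y' / (y' + z'); the term 2 r^2 makes the identity valid over
     any field, as [field] requires. *)
  have -> : d ^+ 3 / e ^+ 2 = (y' / (y' + z')) ^+ 2 + y' / (y' + z') - 2 * (y' / (y' + z')) ^+ 2.
    move: d0; rewrite -yze' -yz' mulf_eq0 negb_or => /andP [y'0 z'0].
    by field; rewrite yz0' y'0 z'0.
  by rewrite two0 mul0r subr0 Dsqr_add.
(* With tau = t^2 + t, d = y^2 (1 + tau) and e = y^3 tau, hence d^3 / e^2 = (1 + tau)^3 / tau^2.
   After expansion every term but the constant 3 has its trace cancelled. *)
have [t zE] : exists t, z = t * y by exists (z / y); rewrite divfK.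
pose tau := t ^+ 2 + t.
have tau0 : tau != 0.
  apply: contraNneq yz0 => h; suff : z * (y + z) = 0 by move/eqP; rewrite mulf_eq0 (negPf z0).
  by transitivity (tau * y ^+ 2); [rewrite zE /tau; ring | rewrite h mul0r].
have -> : d ^+ 3 / e ^+ 2 = (tau^-1) ^+ 2 + 3 * tau^-1 + 3 + tau.
  have -> : d = y ^+ 2 * (1 + tau) by rewrite -yz zE /tau; ring.
  have -> : e = y ^+ 3 * tau by rewrite -yze zE /tau; ring.
  by field; rewrite y0 tau0.
by rewrite three1 mul1r 2!DD Dsqr_add add0r D1 Dsqr_add.
Qed.

Lemma K_cases d e : (d, e) != (0, 0) -> K d e = 0%N \/ K d e = 6%N.
Proof.
move=> de; case: (eqVneq e 0) de => [->|e0 _].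
  by rewrite xpair_eqE eqxx andbT => d0; right; apply: K_E0.
case: (eqVneq d 0) => [->|d0].
  left; rewrite /K; have -> : KA 0 e = set0.
    apply/setP => -[y z]; rewrite !inE /=; apply/negP => /andP [/eqP /no_cubic_root -> /eqP h].
    by rewrite !mul0r in h; rewrite -h eqxx in e0.
  have -> : KB 0 e = set0.
    apply/setP => -[y z]; rewrite !inE /=; apply/negP => /andP [/eqP -> /eqP h].
    by rewrite mul0r in h; rewrite -h eqxx in e0.
  by rewrite !cards0.
rewrite /K; case: (eqVneq (KA d e) set0) => [->|ne].
  by rewrite cards0; case: (KB_cases d0 e0) => ->; [left|right].
rewrite (KAB_excl d0 e0 ne) cards0.
by case: (KA_cases d e0) => ->; [left|right].
Qed.

(* cmom es s counts, up to the factor n, the ways of cancelling the syndrome s by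
   one signed point +-(1, x, x^3) for each sign in es (true for +). *)
Definition pt (e : bool) (x : F) : par :=
  if e then (1, x, 0, x ^+ 3) else oppp (1, x, 0, x ^+ 3).

Fixpoint cmom (es : seq bool) (s : par) : algC :=
  if es is e :: es' then \sum_x cmom es' (addp s (pt e x))
  else if s == par0 then 4 * q ^+ 3 else 0.

Definition ph (e : bool) p := if e then phase p else (phase p)^*.

Lemma phE e p : ph e p = \sum_x chi (pt e x) p.
Proof.
case: e => //; rewrite /ph /phase rmorph_sum; apply: eq_bigr => x _.
by rewrite chiN.
Qed.

Lemma cmomE es s : \sum_p chi s p * \prod_(e <- es) ph e p = cmom es s.
Proof.
elim: es s => [|e es IH] s /=.
  by rewrite -sum_chi; apply: eq_bigr => p _; rewrite big_nil mulr1.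
under [RHS]eq_bigr do rewrite -IH.
rewrite exchange_big /=; apply: eq_bigr => p _.
rewrite big_cons mulrA -mulr_suml; congr (_ * _).
by rewrite phE mulr_sumr; apply: eq_bigr => x _; rewrite chiDl.
Qed.

Lemma cmom_conj es s : cmom (map negb es) (oppp s) = (cmom es s)^*.
Proof.
rewrite -!cmomE rmorph_sum /=; apply: eq_bigr => p _.
rewrite rmorphM /= chiN rmorph_prod big_map /=; congr (_ * _).
by apply: eq_bigr => -[] _ //=; rewrite conjCK.
Qed.

Definition wt4 (e : bool) : 'Z_4 := if e then 1 else -1.

(** Each signed point adds its sign to the Z_4-coordinate, which must end at 0; for a given t this
    leaves few sign patterns. *)
Lemma cmom_neq0 es s : s.1.1.1 + \sum_(e <- es) wt4 e != 0 -> cmom es s = 0.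
Proof.
elim: es s => [|e es IH] s /=; first by rewrite big_nil addr0; case: (eqVneq s par0) => // ->; rewrite eqxx.
rewrite big_cons addrA => ne; rewrite big1 // => x _; apply: IH.
suff -> : (addp s (pt e x)).1.1.1 = s.1.1.1 + wt4 e by [].
by case: e s {ne} => [] [[[t A] B] C].
Qed.

Lemma sum_pick (V : nmodType) c (f : F -> V) (P : pred F) :
  \sum_z (if (c + z == 0) && P z then f z else 0) = if P c then f c else 0.
Proof.
rewrite (bigD1 c) //= addxx eqxx /= big1 ?addr0 // => z.
by rewrite eq_sym -addx_eq0 => /negPf ->.
Qed.

Lemma cmom_p (es : seq bool) (A B C : F) (t : 'Z_4) :
  cmom (true :: es) (t, A, B, C) = \sum_x cmom es (t + 1, A + x, B + A * x, C + x ^+ 3).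
Proof. by apply: eq_bigr => x _ /=; rewrite addr0. Qed.

Lemma cmom_n (es : seq bool) (A B C : F) (t : 'Z_4) :
  cmom (false :: es) (t, A, B, C) =
  \sum_x cmom es (t - 1, A + x, B + x ^+ 2 + A * x, C + x ^+ 3).
Proof. by apply: eq_bigr => x _ /=; rewrite add0r. Qed.

Lemma cmom_nil t A B C : cmom [::] (t, A, B, C) =
  if (t == 0) && ((A == 0) && ((B == 0) && (C == 0))) then 4 * q ^+ 3 else 0.
Proof. by rewrite /= /par0 !xpair_eqE -!andbA. Qed.

Lemma sum_set2 (P : F -> F -> bool) (v : algC) :
  \sum_x \sum_y (if P x y then v else 0) = v * #|[set p : F * F | P p.1 p.2]|%:R.
Proof.
rewrite pair_bigA /= -big_mkcond sumr_const mulr_natr; congr (_ *+ _).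
by apply: eq_card => p; rewrite inE.
Qed.

Lemma sum_set1 (P : pred F) (v : algC) :
  \sum_x (if P x then v else 0) = v * #|[set x | P x]|%:R.
Proof.
rewrite -big_mkcond sumr_const mulr_natr; congr (_ *+ _).
by apply: eq_card => p; rewrite inE.
Qed.

(** * Evaluation of the moments of order at most four *)

Let Z4_1111 : 1 + 1 + 1 + 1 = 0 :> 'Z_4. Proof. exact/val_inj. Qed.
Let Z4_211 : 2 + 1 + 1 = 0 :> 'Z_4. Proof. exact/val_inj. Qed.
Let Z4_2mm : 2 - 1 - 1 = 0 :> 'Z_4. Proof. exact/val_inj. Qed.
Let n : algC := 4 * q ^+ 3.

(** The syndrome is the point at A plus (0, 0, B, C + A^3). So A is a fourth point, the variables
    are shifted to measure the others from it, and the second coordinate determines the last one. *)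
Lemma cmom_ppp A B C : cmom [:: true; true; true] (1, A, B, C) =
  n * #|KA B (C + A ^+ 3)|%:R.
Proof.
rewrite -(sum_set2 (fun y z => (y ^+ 2 + y * z + z ^+ 2 == B) && (y * z * (y + z) == C + A ^+ 3))).
rewrite cmom_p (reindex_inj (addrI A)); apply: eq_bigr => x _.
rewrite cmom_p (reindex_inj (addrI A)); apply: eq_bigr => y _.
rewrite cmom_p; under eq_bigr do rewrite cmom_nil Z4_1111 eqxx andTb.
rewrite sum_pick; congr (if _ then _ else _).
have -> : A + (A + x) = x by ring2.
have -> : x + (A + y) = A + x + y by ring2.
rewrite -[in RHS](addx_eq0 _ B) -[in RHS](addx_eq0 _ (C + _)).
by congr (_ && _); congr (_ == _); ring2.
Qed.

Lemma cmom_pnn A B C : cmom [:: true; false; false] (1, A, B, C) =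
  n * #|KB B (C + A ^+ 3)|%:R.
Proof.
transitivity (\sum_x \sum_y
  if (y * (x + y) == B) && (y * (x + y) * x == C + A ^+ 3) then n else 0); last first.
  rewrite -(sum_set2 (fun y z => (y * z == B) && (y * z * (y + z) == C + A ^+ 3))) exchange_big; apply: eq_bigr => y _.
  rewrite (reindex_inj (addrI y)); apply: eq_bigr => x _ /=.
  have -> : y + x + y = x by ring2.
  by rewrite [y + x]addrC.
rewrite cmom_p (reindex_inj (addrI A)); apply: eq_bigr => x _.
rewrite cmom_n (reindex_inj (addrI A)); apply: eq_bigr => y _.
rewrite cmom_n; under eq_bigr do rewrite cmom_nil addrK subrr eqxx andTb.
rewrite sum_pick; congr (if _ then _ else _).
have -> : A + (A + x) = x by ring2.
have -> : x + (A + y) = A + x + y by ring2.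
rewrite -[in RHS](addx_eq0 _ B) -[in RHS](addx_eq0 _ (C + _)).
by congr (_ && _); congr (_ == _); ring2.
Qed.

Lemma cmom_n1 A B C : cmom [:: false] (1, A, B, C) =
  if (B, C + A ^+ 3) == (0, 0) then n else 0.
Proof.
rewrite cmom_n; under eq_bigr do rewrite cmom_nil subrr eqxx andTb.
rewrite sum_pick xpair_eqE; congr (if _ then _ else _).
by congr (_ && _); congr (_ == _); ring2.
Qed.

(** The choice of the first point only translates the configuration, whence the factor q. *)
Lemma cmom_pppp B C : cmom [:: true; true; true; true] (0, 0, B, C) = q * n * #|KA B C|%:R.
Proof.
rewrite cmom_p; under eq_bigr do rewrite !add0r mul0r addr0 cmom_ppp -addrA addxx addr0.
by rewrite sumr_const -mulrA mulr_natl.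
Qed.

Lemma cmom_nnnn B C : cmom [:: false; false; false; false] (0, 0, B, C) = q * n * #|KA B C|%:R.
Proof.
have E : oppp (0, 0, B, C) = (0, 0, B, C) by rewrite /= oppr0 expr0n addr0.
rewrite -[LHS]/(cmom (map negb [:: true; true; true; true]) (0, 0, B, C)) -{1}E cmom_conj.
by rewrite cmom_pppp /n /q -natrX -!natrM rmorph_nat.
Qed.

Lemma cmom_ppnn B C : cmom [:: true; true; false; false] (0, 0, B, C) = q * n * #|KB B C|%:R.
Proof.
rewrite cmom_p; under eq_bigr do rewrite !add0r mul0r addr0 cmom_pnn -addrA addxx addr0.
by rewrite sumr_const -mulrA mulr_natl.
Qed.

Lemma cmom_pn A B C : A != 0 -> cmom [:: true; false] (0, A, B, C) = 0 \/
  cmom [:: true; false] (0, A, B, C) = n.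
Proof.
move=> A0.
have -> : cmom [:: true; false] (0, A, B, C) =
   \sum_x (if (B / A + x == 0) && (C + A ^+ 3 + A ^+ 2 * x + A * x ^+ 2 == 0) then n else 0).
  rewrite cmom_p; apply: eq_bigr => x _.
  rewrite cmom_n; under eq_bigr do rewrite cmom_nil addrK eqxx andTb.
  rewrite sum_pick; congr (if _ then _ else _).
  congr (_ && _); last by congr (_ == _); ring2.
  rewrite -[RHS](inj_eq (mulfI A0)) mulr0; congr (_ == _).
  by rewrite [in RHS]mulrDr [in RHS](mulrC A (B / A)) divfK //; ring2.
by rewrite sum_pick; case: ifP => _; [right | left].
Qed.

Lemma card_quad (A e : F) : A != 0 ->
  #|[set x | x ^+ 2 + A * x == e]| = 0%N \/ #|[set x | x ^+ 2 + A * x == e]| = 2%N.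
Proof.
move=> A0; case: (set_0Vmem [set x | x ^+ 2 + A * x == e]) => [->|[y]].
  by left; rewrite cards0.
rewrite inE => /eqP <-; right; apply: (@card_seq _ _ [:: y; y + A]); last first.
  by rewrite /= inE -addx_eq0 addrA addxx add0r A0.
move=> x; rewrite !inE -addx_eq0.
rewrite (_ : _ + _ + _ = (x + y) * (x + (y + A))); last by ring2.
by rewrite mulf_eq0 !addx_eq0.
Qed.

(** Both patterns give a quadratic x^2 + A x = b, with b = B + A^2 or b = B, on whose roots the
    cubic condition is the constant one C + A^3 + A b = 0. If A is nonzero these constants differ by
    A^3, so at most one pattern contributes, with 0 or 2 roots. If A = 0 the patterns agree, and
    each has one root or none. *)
Lemma cmom_pp_nn A B C :
  cmom [:: true; true] (2, A, B, C) + cmom [:: false; false] (2, A, B, C) \in [:: 0; 2 * n].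
Proof.
have -> : cmom [:: true; true] (2, A, B, C) = n *
   #|[set x | (x ^+ 2 + A * x == B + A ^+ 2) && (C + A ^+ 3 + A ^+ 2 * x + A * x ^+ 2 == 0)]|%:R.
  rewrite -sum_set1 cmom_p; apply: eq_bigr => x _.
  rewrite cmom_p; under eq_bigr do rewrite cmom_nil Z4_211 eqxx andTb.
  rewrite sum_pick -(addx_eq0 (_ + A * x)); congr (if _ then _ else _).
  by congr (_ && _); congr (_ == _); ring2.
have -> : cmom [:: false; false] (2, A, B, C) = n *
   #|[set x | (x ^+ 2 + A * x == B) && (C + A ^+ 3 + A ^+ 2 * x + A * x ^+ 2 == 0)]|%:R.
  rewrite -sum_set1 cmom_n; apply: eq_bigr => x _.
  rewrite cmom_n; under eq_bigr do rewrite cmom_nil Z4_2mm eqxx andTb.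
  rewrite sum_pick -(addx_eq0 (_ + A * x)); congr (if _ then _ else _).
  by congr (_ && _); congr (_ == _); ring2.
have key b : #|[set x | (x ^+ 2 + A * x == b) && (C + A ^+ 3 + A ^+ 2 * x + A * x ^+ 2 == 0)]|
   = if C + A ^+ 3 + A * b == 0 then #|[set x | x ^+ 2 + A * x == b]| else 0%N.
  have E x : x ^+ 2 + A * x = b ->
      C + A ^+ 3 + A ^+ 2 * x + A * x ^+ 2 = C + A ^+ 3 + A * b by move=> <-; ring.
  case: ifP => h0; [apply: eq_card | apply: eq_card0] => x; rewrite !inE;
    by case: eqP => //= /E ->; rewrite h0.
rewrite !key -mulrDr !inE; case: (eqVneq A 0) => [->|A0].
  rewrite !mul0r expr0n !addr0; case: ifP => _; last by rewrite addr0 mulr0 eqxx.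
  have [e ->] := sqr_surj B.
  have this_e : [set x : F | x ^+ 2 + 0 * x == e ^+ 2] = [set e].
    by apply/setP => x; rewrite !inE mul0r addr0 (inj_eq sqr_inj).
  by rewrite (expr2 0) mul0r addr0 this_e cards1 -natrD mulrC eqxx orbT.
case: (eqVneq (C + A ^+ 3 + A * B) 0) => [e|ne].
  have -> : C + A ^+ 3 + A * (B + A ^+ 2) = A ^+ 3 by rewrite mulrDr addrA e add0r; ring.
  rewrite expf_eq0 (negPf A0) andbF add0r.
  by case: (card_quad B A0) => ->; rewrite ?mulr0 ?eqxx // mulrC eqxx orbT.
rewrite addr0; case: ifP => _; last by rewrite mulr0 eqxx.
by case: (card_quad (B + A ^+ 2) A0) => ->; rewrite ?mulr0 ?eqxx // mulrC eqxx orbT.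
Qed.

(** * From the moments to the rows of P *)

Definition rt : algC := (2 * h)%:~R.

Lemma q_rt : q = rt ^+ 2 / 2.
Proof. by rewrite q_h /rt !rmorphM /=; field. Qed.

Lemma n_rt : n = rt ^+ 6 / 2.
Proof. by rewrite /n q_rt; field. Qed.

Lemma rt_neq0 : rt != 0.
Proof. by rewrite /rt intr_eq0 mulf_neq0 //; have := h_ge2; lia. Qed.

Definition mom s k := \sum_p chi s p * (phase p + (phase p)^*) ^+ k.

(** The values of 2 lam are rt^2, 2 rt, rt, 0 and their opposites; the positive exponent drops
    classes 3 and 4. *)
Lemma mom_esum s k : mom s k.+1 = (rt ^+ 2) ^+ k.+1 + (2 * rt) ^+ k.+1 * esum s 1 +
  rt ^+ k.+1 * esum s 2 + (- rt) ^+ k.+1 * esum s 5 + (- (2 * rt)) ^+ k.+1 * esum s 6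
  + (- rt ^+ 2) ^+ k.+1 * esum s 7.
Proof.
rewrite /mom momE sum8 /lval /= esum0.
have E : (2 * (2 * h ^+ 2))%:~R = rt ^+ 2 :> algC.
  by rewrite /rt !rmorphM /=; ring.
have E2 : (2 * (2 * h))%:~R = 2 * rt :> algC by rewrite (rmorphM intr) /=.
rewrite !mulr0 !mulrN !rmorphN rmorph0 /= E E2 -/rt.
by rewrite expr0n /= !mul0r !addr0 mulr1.
Qed.

Lemma esum_total s : esum s 0 + esum s 1 + esum s 2 + esum s 3 + esum s 4 + esum s 5
  + esum s 6 + esum s 7 = if s == par0 then n else 0.
Proof.
rewrite -sum8 -sum_chi; transitivity (\sum_j 1 * esum s j).
  by apply: eq_bigr => j _; rewrite mul1r.
by rewrite -(sum_cls s (fun=> 1)); apply: eq_bigr => p _; rewrite mulr1.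
Qed.

Lemma mom1 s : mom s 1 = cmom [:: true] s + cmom [:: false] s.
Proof.
rewrite -!cmomE -big_split; apply: eq_bigr => p _.
by rewrite !big_seq1 /ph /=; ring.
Qed.

Lemma mom2 s : mom s 2 =
  cmom [:: true; true] s + 2 * cmom [:: true; false] s + cmom [:: false; false] s.
Proof.
rewrite -!cmomE mulr_sumr -!big_split; apply: eq_bigr => p _.
by rewrite !big_cons !big_nil /ph /=; ring.
Qed.

Lemma mom3 s : mom s 3 = cmom [:: true; true; true] s + 3 * cmom [:: true; true; false] s
  + 3 * cmom [:: true; false; false] s + cmom [:: false; false; false] s.
Proof.
rewrite -!cmomE !mulr_sumr -!big_split; apply: eq_bigr => p _.
by rewrite !big_cons !big_nil /ph /=; ring.
Qed.

Lemma mom4 s : mom s 4 = cmom [:: true; true; true; true] s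
  + 4 * cmom [:: true; true; true; false] s + 6 * cmom [:: true; true; false; false] s
  + 4 * cmom [:: true; false; false; false] s + cmom [:: false; false; false; false] s.
Proof.
rewrite -!cmomE !mulr_sumr -!big_split; apply: eq_bigr => p _.
by rewrite !big_cons !big_nil /ph /=; ring.
Qed.

Ltac cmom0 := rewrite cmom_neq0; last by rewrite !big_cons big_nil.

Lemma mom1_odd A B C : mom (1, A, B, C) 1 = if (B, C + A ^+ 3) == (0, 0) then n else 0.
Proof. by rewrite mom1 cmom_n1; cmom0; rewrite add0r. Qed.

Lemma mom3_odd A B C : mom (1, A, B, C) 3 = n * (K B (C + A ^+ 3))%:R.
Proof.
rewrite mom3 cmom_ppp cmom_pnn; do 2!cmom0.
by rewrite /K natrD natrM; ring.
Qed.

Lemma mom4_even B C : mom (0, 0, B, C) 4 = 2 * q * n * (K B C)%:R.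
Proof.
rewrite mom4 cmom_pppp cmom_ppnn cmom_nnnn; do 2!cmom0.
by rewrite /K natrD natrM; ring.
Qed.

Lemma mom2_even00 B C : mom (0, 0, B, C) 2 = if (0, 0, B, C) == par0 then 2 * q * n else 0.
Proof.
rewrite mom2; cmom0; rewrite [X in _ + X]cmom_neq0; last by rewrite !big_cons big_nil.
rewrite add0r addr0.
have -> : cmom [:: true; false] (0, 0, B, C) =
   \sum_(x : F) (if (B == 0) && (C == 0) then n else 0).
  rewrite cmom_p; apply: eq_bigr => x _.
  rewrite cmom_n; under eq_bigr do rewrite cmom_nil addrK eqxx andTb.
  rewrite sum_pick; congr (if _ then _ else _).
  by congr (_ && _); congr (_ == _); ring2.
rewrite sumr_const /par0 !xpair_eqE !eqxx /=.
by case: ifP => _; rewrite ?mul0rn ?mulr0 // -mulr_natl -/q; ring.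
Qed.

Lemma mom2_even t A B C : t *+ 2 = 0 -> (t, A) != (0, 0) ->
  mom (t, A, B, C) 2 = 0 \/ mom (t, A, B, C) 2 = 2 * n.
Proof.
move=> t2 tA; have [t0|t0] : t = 0 \/ t = 2.
  by move: t2; elim/Z4_ind: t {tA} => //; [left | right].
  rewrite t0 mom2; cmom0; rewrite [X in _ + X]cmom_neq0; last by rewrite !big_cons big_nil.
  move: tA; rewrite t0 xpair_eqE eqxx andTb => A0.
  by rewrite add0r addr0; case: (cmom_pn B C A0) => ->; [left; rewrite mulr0 | right].
rewrite t0 mom2 [X in _ + 2 * X + _]cmom_neq0; last by rewrite !big_cons big_nil.
by rewrite mulr0 addr0; have := cmom_pp_nn A B C; rewrite !inE => /orP [] /eqP ->; [left|right].
Qed.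

(** Antisymmetry under [opp8] kills classes 3 and 4 and leaves classes 1 and 2 as unknowns, solved
    from moments 1 and 3. The count K is 6q - 2, 0 or 6, giving rows 2, 3 and 6. *)
Lemma esum_row_odd A B C : exists i, forall j, esum (1, A, B, C) j = Pmx rt i j.
Proof.
set s := (1, A, B, C); move: (mom_esum s 0) (mom_esum s 2) rt_neq0 n_rt q_rt.
generalize rt => r M1 M3 r0 nr qr.
have e7 : esum s 7 = -1 by rewrite esum7 omega2.
have opp j : esum s (opp8 j) = - esum s j by rewrite esum_opp omega2 mulN1r.
have e6 : esum s 6 = - esum s 1 by rewrite -opp.
have e5 : esum s 5 = - esum s 2 by rewrite -opp.
have f4 : esum s 4 = 0.
  by apply/eqP; rewrite -[_ == 0](mulrn_eq0 _ 2) mulr2n -{1}[esum s 4]opprK -opp addNr.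
have e3 : esum s 3 = 0.
  by apply/eqP; rewrite -[_ == 0](mulrn_eq0 _ 2) mulr2n -{1}[esum s 3]opprK -opp addNr.
rewrite e5 e6 e7 in M1 M3.
have E1 : esum s 1 = (mom s 3 - r ^+ 2 * mom s 1 - 2 * r ^+ 6 + 2 * r ^+ 4) / (12 * r ^+ 3).
  by rewrite M1 M3; field.
have E2 : esum s 2 = (mom s 1 - 2 * r ^+ 2 - 4 * r * esum s 1) / (2 * r).
  by rewrite M1; field.
have m1 := mom1_odd A B C; have m3 := mom3_odd A B C; rewrite -/s in m1 m3.
case: (eqVneq (B, C + A ^+ 3) (0, 0)) m1 => [[b0 c0]|ne] m1.
  have Kq : (K B (C + A ^+ 3))%:R = 3 * r ^+ 2 - 2 :> algC.
    by rewrite b0 c0; apply: (@addIr _ 2); rewrite -natrD K00 natrM -/q qr; field.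
  rewrite m1 m3 Kq nr in E1 E2; exists 2.
  by elim/I8_ind; rewrite mxE /= ?esum0 ?e3 ?f4 ?e5 ?e6 ?e7 ?E2 ?E1 //; field.
case: (K_cases ne) => Ke; rewrite m1 m3 Ke nr in E1 E2.
  exists 3.
  by elim/I8_ind; rewrite mxE /= ?esum0 ?e3 ?f4 ?e5 ?e6 ?e7 ?E2 ?E1 //; field.
exists 6.
by elim/I8_ind; rewrite mxE /= ?esum0 ?e3 ?f4 ?e5 ?e6 ?e7 ?E2 ?E1 //; field.
Qed.

(** Symmetry leaves classes 1 to 4; class 3 comes from [esum037] and class 4 from the total. The row
    index of the zero label is kept because row 0 holds the valencies, used in [cls_surj]. *)
Lemma esum_row_even t A B C : t *+ 2 = 0 ->
  exists2 i, ((t, A, B, C) == par0 -> i = 0) & forall j, esum (t, A, B, C) j = Pmx rt i j.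
Proof.
move=> t2; set s := (t, A, B, C); move: (mom_esum s 1) (mom_esum s 3) rt_neq0 n_rt q_rt.
generalize rt => r M2 M4 r0 nr qr.
have e7 : esum s 7 = 1 by rewrite esum7 t2 omega0.
have opp j : esum s (opp8 j) = esum s j by rewrite esum_opp t2 omega0 mul1r.
have e6 : esum s 6 = esum s 1 by rewrite -opp.
have e5 : esum s 5 = esum s 2 by rewrite -opp.
rewrite e5 e6 e7 in M2 M4.
have tot := esum_total s; rewrite esum0 e5 e6 e7 in tot.
have E4 : esum s 4 = (if s == par0 then n else 0) - 2 - 2 * esum s 1 - 2 * esum s 2 - esum s 3.
  by rewrite -tot; ring.
have e037 := esum037 t A B C; rewrite -/s esum0 e7 in e037.
have e3 : esum s 3 = (if (t, A) == (0, 0) then 4 * q else 0) - 2 by rewrite -e037; ring.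
case: (eqVneq (t, A) (0, 0)) e3 => [[t0 A0]|tA] e3.
  have E1 : esum s 1 = (mom s 4 - r ^+ 2 * mom s 2 - 2 * r ^+ 8 + 2 * r ^+ 6) / (24 * r ^+ 4).
    by rewrite M2 M4; field.
  have E2 : esum s 2 = (mom s 2 - 2 * r ^+ 4 - 8 * r ^+ 2 * esum s 1) / (2 * r ^+ 2).
    by rewrite M2; field.
  have m2 := mom2_even00 B C; have m4 := mom4_even B C.
  have sE : s = (0, 0, B, C) by rewrite /s t0 A0.
  rewrite -sE in m2 m4.
  case: (eqVneq s par0) E4 m2 => [s0|ne] E4 m2.
    have Kq : (K B C)%:R = 3 * r ^+ 2 - 2 :> algC.
      have [-> ->] : B = 0 /\ C = 0 by move: s0; rewrite sE /par0 => -[-> ->].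
      by apply: (@addIr _ 2); rewrite -natrD K00 natrM -/q qr; field.
    rewrite qr ?nr in e3 E4; rewrite m2 m4 Kq qr nr in E1 E2; exists 0 => //.
    by elim/I8_ind; rewrite mxE /= ?esum0 ?e5 ?e6 ?e7 ?E4 ?e3 ?E2 ?E1 //; field.
  have ne' : (B, C) != (0, 0).
    by apply: contra ne; rewrite sE /par0 !xpair_eqE !eqxx.
  rewrite qr in e3; case: (K_cases ne') => Ke; rewrite m2 m4 Ke qr nr in E1 E2; [exists 1 | exists 7];
    try (by rewrite ?(negPf ne)); by elim/I8_ind; rewrite mxE /= ?esum0 ?e5 ?e6 ?e7 ?E4 ?e3 ?E2 ?E1 //; field.
have e2 : esum s 2 = 0.
  have := esum25 B C tA; rewrite -/s e5 -mulr2n => /eqP.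
  by rewrite mulrn_eq0 => /eqP.
have E1 : esum s 1 = (mom s 2 - 2 * r ^+ 4) / (8 * r ^+ 2).
  by rewrite M2 e2; field.
have sn : (s == par0) = false.
  by apply: contraNF tA; rewrite /s /par0 !xpair_eqE -!andbA => /and4P [-> ->].
rewrite sn in E4.
case: (mom2_even B C t2 tA) => m2; rewrite -/s in m2; rewrite m2 ?nr in E1; [exists 5 | exists 4];
  try (by rewrite ?sn); by elim/I8_ind; rewrite mxE /= ?esum0 ?e5 ?e6 ?e7 ?E4 ?e3 ?e2 ?E1 //; field.
Qed.

Lemma esum_row s : exists2 i, (s == par0 -> i = 0) & forall j, esum s j = Pmx rt i j.
Proof.
case: s => [[[t A] B] C]; elim/Z4_ind: t.
- by apply: esum_row_even; apply/val_inj.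
- by have [i E] := esum_row_odd A B C; exists i; rewrite // /par0 !xpair_eqE.
- by apply: esum_row_even; apply/val_inj.
(* The label (3, A, B, C) is the opposite of (1, A, B + A^2, C), and opposite labels have equal
   sums. *)
- have [i E] := esum_row_odd A (B + A ^+ 2) C; exists i => [|j]; first by rewrite /par0 !xpair_eqE.
  rewrite -E -(esumN (1, A, _, C)) /= -addrA addxx addr0.
  by congr (esum (_, A, B, C) j); apply/val_inj.
Qed.

(** An empty class would have valency 0, but the entries of row 0 factor through s^2, s^2 - 1, s^2 -
    2 and s^2 + 8, all nonzero since s^2 = 4 h^2. *)
Lemma cls_surj j : exists p, cls p = j.
Proof.
suff /existsP [p /eqP e] : [exists p, cls p == j] by exists p.
apply: contraT; rewrite negb_exists => /forallP ne.
have [i /(_ (eqxx _)) -> E] := esum_row par0.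
have: Pmx rt 0 j = 0.
  by rewrite -E /esum big_pred0 // => p; apply/negbTE; have := ne p.
have rt2 : rt ^+ 2 = (4 * h ^+ 2)%:~R by rewrite /rt !rmorphM /=; ring.
have h1 : 1 <= h ^+ 2 by rewrite exprn_ege1 //; have := h_ge2; lia.
have nz (k : int) : k <= 3 -> rt ^+ 2 - k%:~R != 0.
  by move=> k3; rewrite rt2 -rmorphB /= intr_eq0; lia.
have n1 := nz 1 isT; have n2 := nz 2 isT; have n8 := nz (-8) isT.
rewrite rmorphN opprK in n8.
have p1 : rt ^+ 6 / 24 - rt ^+ 4 / 8 + rt ^+ 2 / 12 != 0.
  rewrite (_ : _ + _ = rt ^+ 2 * (rt ^+ 2 - 1%:~R) * (rt ^+ 2 - 2%:~R) / 24); last by field.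
  by rewrite !mulf_eq0 !negb_or rt_neq0 ?n1 ?n2 ?n8 invr_eq0 pnatr_eq0.
have p2 : rt ^+ 6 / 12 + rt ^+ 4 / 2 - 4 * rt ^+ 2 / 3 != 0.
  rewrite (_ : _ + _ = rt ^+ 2 * (rt ^+ 2 + 8%:~R) * (rt ^+ 2 - 2%:~R) / 12); last by field.
  by rewrite !mulf_eq0 !negb_or rt_neq0 ?n1 ?n2 ?n8 invr_eq0 pnatr_eq0.
have p3 : 2 * rt ^+ 2 - 2 != 0.
  by rewrite (_ : _ - _ = 2 * (rt ^+ 2 - 1%:~R)) ?mulf_neq0 ?pnatr_eq0 //; ring.
have p4 : rt ^+ 6 / 4 - 3 * rt ^+ 4 / 4 + rt ^+ 2 / 2 != 0.
  rewrite (_ : _ + _ = rt ^+ 2 * (rt ^+ 2 - 1%:~R) * (rt ^+ 2 - 2%:~R) / 4); last by field.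
  by rewrite !mulf_eq0 !negb_or rt_neq0 ?n1 ?n2 ?n8 invr_eq0 pnatr_eq0.
by elim/I8_ind: j {ne}; rewrite mxE /= => /eqP; apply: contraTT => _ //; rewrite oner_eq0.
Qed.

Lemma clsN p : cls (oppp p) = cls p.
Proof. by rewrite /cls lamN; case: p => [[[]]]. Qed.

Lemma opppD p r : oppp (addp p (oppp r)) = addp r (oppp p).
Proof.
case: p r => [[[t A] B] C] [[[u a] b] c] /=.
by rewrite opprB [a + A]addrC [c + C]addrC; congr (_, _, _, _); ring2.
Qed.

Lemma addNp p : addp (oppp p) p = par0.
Proof. by rewrite addpC addpN. Qed.

Lemma addp_eq0 p r : (addp p (oppp r) == par0) = (p == r).
Proof.
apply/eqP/eqP => [e|->]; last exact: addpN.
by rewrite -[p]addp0 -(addNp r) addpA e addpC addp0.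
Qed.

(** * The association scheme on an index set in bijection with the quadruples *)

Section Scheme.
Variables (k : nat) (Rl : 'I_8 -> rel 'I_k) (pp : 'I_k -> par).
Hypothesis pp_bij : bijective pp.
Hypothesis RlE : forall i x y, Rl i x y = (cls (addp (pp x) (oppp (pp y))) == i).

Let X x s := chi s (pp x).
(** By [esum_row] a row is always found, so the default [ord0] never arises. *)
Let ty s : 'I_8 := odflt ord0 [pick i | [forall j, esum s j == Pmx rt i j]].

Lemma ty_esum s j : esum s j = Pmx rt (ty s) j.
Proof.
rewrite /ty; case: pickP => [i /forallP /(_ j) /eqP //|/=].
by have [i _ E] := esum_row s; move=> /(_ i) /forallP []; move=> l; rewrite E.
Qed.

Lemma n_neq0 : n != 0.
Proof.
rewrite n_rt mulf_neq0 ?invr_eq0 ?pnatr_eq0 // expf_neq0 //; exact: rt_neq0.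
Qed.

Lemma pp_chi (f : par -> algC) : \sum_x f (pp x) = \sum_p f p.
Proof. by rewrite [RHS](reindex pp) //; exact: onW_bij. Qed.

Lemma chi_col s s' : \sum_x (X x s)^* * X x s' = if s == s' then n else 0.
Proof.
under eq_bigr do rewrite /X -chiN -chiDl.
rewrite (pp_chi (chi (addp (oppp s) s'))) sum_chi addpC.
by rewrite addp_eq0 eq_sym.
Qed.

Lemma chi_row x y : \sum_s X x s * (X y s)^* = if x == y then n else 0.
Proof.
under eq_bigr do rewrite /X !(chiC _ (pp _)) -chiN -chiDl.
by rewrite sum_chi addp_eq0 (inj_eq (bij_inj pp_bij)).
Qed.

Lemma chi_eigen j x s : \sum_y (Rl j x y)%:R * X y s = Pmx rt (ty s) j * X x s.
Proof.
rewrite -ty_esum /X /esum.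
under eq_bigr do rewrite RlE.
rewrite (pp_chi (fun p => (cls (addp (pp x) (oppp p)) == j)%:R * chi s p)).
have inj : injective (addp (pp x)).
  by move=> p r; rewrite addpC [RHS]addpC => /addp_inj.
rewrite (reindex_inj inj) mulr_suml [RHS]big_mkcond; apply: eq_bigr => p _ /=.
rewrite -{1}[p]opppK opppD addpC -addpA addNp addp0 clsN.
by case: ifP => _; rewrite ?mul0r // mul1r chiDr mulrC.
Qed.

Lemma Rl_part x y : exists! i, Rl i x y.
Proof.
by exists (cls (addp (pp x) (oppp (pp y)))); split=> [|i]; rewrite RlE // => /eqP.
Qed.

Lemma Rl_ne i : exists x y, Rl i x y.
Proof.
have [p <-] := cls_surj i; have [g gK Kg] := pp_bij.
exists (g p), (g par0); rewrite RlE !Kg; apply/eqP; congr cls.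
by rewrite /= oppr0 expr0n addr0 addp0.
Qed.

Lemma Rl_sym i x y : Rl i x y = Rl i y x.
Proof. by rewrite !RlE -clsN opppD. Qed.

Let E := char_idem X n ty.
Let AE := adj_char_idem n_neq0 chi_row chi_eigen.
Let EE := char_idem_mul ty n_neq0 chi_col.
Let Pu := Pmx_unit rt_neq0.

Theorem cls_scheme :
  [/\ is_assoc_scheme Rl, commutative_scheme Rl, symmetric_scheme Rl &
    exists E, [/\ primitive_idem_enum (fun j => adjmx (Rl j)) E,
      first_eigenmatrix (fun j => adjmx (Rl j)) E (Pmx rt), Pmx rt \in unitmx &
      second_eigenmatrix (fun j => adjmx (Rl j)) E (k%:R *: invmx (Pmx rt))]].
Proof.
split.
- split.
  + exact: Rl_part.
  + by move=> x y; rewrite RlE cls_eq0 addp_eq0 (inj_eq (bij_inj pp_bij)).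
  + exact: Rl_ne.
  + by move=> i; exists i => x y; exact: Rl_sym.
  + move=> i j l x y x' y'; exact: (intersection_number Rl_part AE Pu EE).
- exact: (BM_commutative AE EE).
- exact: Rl_sym.
exists E; split.
- exact: (E_enum Rl_part Rl_ne AE Pu EE).
- exact: AE.
- exact: Pu.
- exact: (BM_second Rl_ne AE Pu).
Qed.

End Scheme.

End Abstract.

(** * The Teichmuller lift *)

Section Teichmuller.
Variables (R : comNzRingType) (F : finFieldType) (mu : {rmorphism R -> F}) (m : nat).
Hypotheses (cardF : #|F| = (2 ^ m)%N) (m_gt0 : (0 < m)%N).
Hypothesis four0 : 4 = 0 :> R.
Hypothesis mu_surj : forall x, exists z, mu z == x.
Hypothesis mu_ker : forall z, mu z = 0 -> exists w, z = w *+ 2.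
Hypothesis mu_half : forall w : R, w *+ 2 = 0 -> mu w = 0.

Lemma mu_eq a b : mu a = mu b -> exists c, a = b + c *+ 2.
Proof.
move=> e; have [|c ec] := @mu_ker (a - b); first by rewrite rmorphB e subrr.
by exists c; rewrite -ec addrC subrK.
Qed.

Lemma sqr_eq_mu a b : mu a = mu b -> a ^+ 2 = b ^+ 2.
Proof. by case/mu_eq => c ->; ring: four0. Qed.

Lemma mul2_eq_mu a b : mu a = mu b -> a *+ 2 = b *+ 2.
Proof. by case/mu_eq => c ->; ring: four0. Qed.

Lemma expq_eq_mu a b : mu a = mu b -> a ^+ (2 ^ m) = b ^+ (2 ^ m).
Proof. by move=> e; rewrite -(prednK m_gt0) expnS !exprM (sqr_eq_mu e). Qed.

(** Two lifts of x differ by some 2c, which squaring kills as 4 = 0, so the power does not depend on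
    the lift; it still reduces to x because x^q = x. *)
Definition tau (x : F) : R := xchoose (mu_surj x) ^+ (2 ^ m).

Lemma mu_lift x : mu (xchoose (mu_surj x)) = x.
Proof. exact/eqP/(xchooseP (mu_surj x)). Qed.

Lemma mu_tau x : mu (tau x) = x.
Proof. by rewrite rmorphXn /= mu_lift -cardF expf_card. Qed.

Lemma tau_fix x : tau x ^+ (2 ^ m) = tau x.
Proof. by apply: expq_eq_mu; rewrite mu_tau mu_lift. Qed.

Lemma tauK z : z ^+ (2 ^ m) = z -> tau (mu z) = z.
Proof.
by move=> zq; rewrite -[RHS]zq; apply: expq_eq_mu; rewrite mu_lift.
Qed.

Lemma tauM x y : tau (x * y) = tau x * tau y.
Proof. by rewrite -[RHS]tauK ?rmorphM /= ?mu_tau // exprMn !tau_fix. Qed.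

Lemma tau1 : tau 1 = 1.
Proof. by rewrite -[RHS]tauK ?rmorph1 // expr1n. Qed.

Lemma tau0 : tau 0 = 0.
Proof. by rewrite -[RHS]tauK ?rmorph0 // expr0n expn_eq0. Qed.

Lemma tauX x k : tau (x ^+ k) = tau x ^+ k.
Proof. by elim: k => [|k IHk]; rewrite ?tau1 // !exprS tauM IHk. Qed.

(** Both tau x + tau y and tau (x + y) lift x + y, so they have the same square. *)
Lemma tau_sqrD x y : tau ((x + y) ^+ 2) = tau (x ^+ 2) + tau (y ^+ 2) + tau (x * y) *+ 2.
Proof.
rewrite !tauX tauM; transitivity ((tau x + tau y) ^+ 2); last by ring.
by apply: sqr_eq_mu; rewrite rmorphD /= !mu_tau.
Qed.

Lemma tauD2 x y : tau (x + y) *+ 2 = tau x *+ 2 + tau y *+ 2.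
Proof. by rewrite -mulrnDl; apply: mul2_eq_mu; rewrite rmorphD /= !mu_tau. Qed.

Lemma teich_repr z : exists x y, z = tau x + tau y *+ 2.
Proof.
have [|w ew] := @mu_ker (z - tau (mu z)); first by rewrite rmorphB /= mu_tau subrr.
exists (mu z), (mu w); rewrite (@mul2_eq_mu _ w) ?mu_tau // -ew.
by rewrite addrC subrK.
Qed.

Lemma mu_two : mu 2 = 0.
Proof.
by rewrite rmorph_nat; apply: (two0 cardF).
Qed.

Lemma teich_uniq x y x' y' :
  tau x + tau y *+ 2 = tau x' + tau y' *+ 2 -> x = x' /\ y = y'.
Proof.
move=> e; have xx : x = x'.
  by have := congr1 mu e; rewrite -!(mulr_natr (tau _)) !rmorphD !rmorphM /= !mu_two !mulr0 !addr0 !mu_tau.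
split=> //; have : (tau y - tau y') *+ 2 = 0.
  by move: e; rewrite xx => /addrI e; rewrite mulrnBl e subrr.
by move/mu_half; rewrite rmorphB /= !mu_tau => /eqP; rewrite subr_eq0 => /eqP.
Qed.

Definition trT (x : F) : R := \sum_(i < m) tau (x ^+ (2 ^ i)).

Lemma trT_sqr x : trT (x ^+ 2) = trT x.
Proof.
(* Split off the first term on one side and the last on the other: both are tau x. *)
have E : \sum_(i < m.+1) tau (x ^+ (2 ^ i)) = \sum_(i < m.+1) tau (x ^+ (2 ^ i)) by [].
move: E; rewrite {1}big_ord_recl big_ord_recr /= -cardF expf_card expr1 addrC => /addrI E; rewrite [RHS]/trT -E.
by apply: eq_bigr => i _; rewrite -exprM -expnS.
Qed.

Lemma pow2D (x y : F) i : (x + y) ^+ (2 ^ i) = x ^+ (2 ^ i) + y ^+ (2 ^ i).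
Proof. by elim: i => [|i IHi]; rewrite ?expr1 // expnSr !exprM IHi (sqrD cardF). Qed.

Lemma trTD x y : trT (x + y) = trT x + trT y + trT (x * y) *+ 2.
Proof.
(* Passing to squares makes [tau_sqrD] applicable and avoids the square root of x y. *)
rewrite -trT_sqr -(trT_sqr x) -(trT_sqr y) -sumrMnl -!big_split; apply: eq_bigr => i _ /=.
by rewrite -!exprM ![(2 * _)%N]mulnC !exprM pow2D tau_sqrD exprMn.
Qed.

Lemma trT1 : trT 1 = m%:R.
Proof.
rewrite /trT (eq_bigr (fun=> 1)); first by rewrite sumr_const card_ord.
by move=> i _; rewrite expr1n tau1.
Qed.

End Teichmuller.

(** * Reduction modulo 2, from Z_4 to F_2 and from Z_4[x]/(f) to its residue field *)

Lemma red2_add : zmod_morphism red2.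
Proof.
by move=> x y; elim/Z4_ind: x; elim/Z4_ind: y; apply/val_inj.
Qed.
Lemma red2_mul : monoid_morphism red2.
Proof.
by split=> [|x y]; [apply/val_inj | elim/Z4_ind: x; elim/Z4_ind: y; apply/val_inj].
Qed.
HB.instance Definition _ := GRing.isZmodMorphism.Build 'Z_4 'F_2 red2 red2_add.
HB.instance Definition _ := GRing.isMonoidMorphism.Build 'Z_4 'F_2 red2 red2_mul.

Lemma red2_ker x : red2 x = 0 -> exists y, x = y *+ 2.
Proof.
elim/Z4_ind: x => // _.
- by exists 0; rewrite mul0rn.
- by exists 1.
Qed.

Lemma red2_half x : x *+ 2 = 0 -> red2 x = 0.
Proof. by elim/Z4_ind: x => // _; apply/val_inj. Qed.

Lemma red2_lift (x : 'F_2) : red2 (val x)%:R = x.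
Proof. by case: x => [[|[|//]]] i; apply/val_inj. Qed.

Section Reduction.
Variables (A : comNzRingType) (B : finFieldType) (red : {rmorphism A -> B}).
Variables (m : nat) (f : {poly A}).
Hypotheses (m_gt0 : (0 < m)%N) (f_monic : f \is monic) (size_f : size f = m.+1).
Hypothesis f_irr : irreducible_poly (map_poly red f).

Local Notation fb := (map_poly red f).
Lemma fb_monic : fb \is monic. Proof. exact: monic_map. Qed.
Lemma fb_mi : monic_irreducible_poly fb.
Proof. by split; [exact: f_irr | exact: fb_monic]. Qed.

Lemma size_fb : size fb = m.+1.
Proof.
rewrite size_map_poly_id0 ?size_f // (monicP f_monic).
by rewrite rmorph1 oner_eq0.
Qed.

Lemma mk_monic_f : mk_monic f = f.
Proof. by rewrite /mk_monic size_f f_monic ltnS m_gt0. Qed.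

Lemma mk_monic_fb : mk_monic fb = fb.
Proof. by rewrite /mk_monic size_fb fb_monic ltnS m_gt0. Qed.

Definition Fq := {poly %/ fb with fb_mi}.

Definition redq (a : {poly %/ f}) : {poly %/ fb} := in_qpoly fb (map_poly red a).

Lemma in_qpoly_fb_eq (p r : {poly A}) : 
  in_qpoly fb (map_poly red (p * f + r)) = in_qpoly fb (map_poly red r).
Proof.
apply/val_inj; rewrite /= mk_monic_fb rmorphD rmorphM /=.
by rewrite Pdiv.RingMonic.rmodpD ?fb_monic // Pdiv.RingMonic.rmodp_mull ?fb_monic // add0r.
Qed.

Lemma redq_in p : redq (in_qpoly f p) = in_qpoly fb (map_poly red p).
Proof.
by rewrite /redq /= mk_monic_f [in RHS](Pdiv.RingMonic.rdivp_eq f_monic p) in_qpoly_fb_eq.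
Qed.

Lemma redq_add : zmod_morphism redq.
Proof.
move=> a b; apply: (addIr (redq b)); rewrite subrK /redq -in_qpolyD -rmorphD.
by rewrite /= subrK.
Qed.

Lemma redq_mul : monoid_morphism redq.
Proof.
split=> [|a b].
  by rewrite -(in_qpoly1 f) redq_in rmorph1 in_qpoly1.
by rewrite -[a * b]/(in_qpoly f ((a : {poly A}) * b)) redq_in rmorphM in_qpolyM.
Qed.


Definition redM : {rmorphism {poly %/ f} -> Fq} :=
  HB.pack (redq : {poly %/ f} -> Fq)
    (GRing.isZmodMorphism.Build {poly %/ f} Fq redq redq_add)
    (GRing.isMonoidMorphism.Build {poly %/ f} Fq redq redq_mul).

Lemma card_Fq : #|{: Fq}| = (#|B| ^ m)%N.
Proof. by rewrite card_qfpoly size_fb. Qed.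

Hypothesis red_surj : forall x, exists z, red z = x.
Hypothesis red_ker : forall z, red z = 0 -> exists w, z = w *+ 2.
Hypothesis red_half : forall w, w *+ 2 = 0 -> red w = 0.

Lemma size_qpoly (a : {poly %/ f}) : (size a <= m)%N.
Proof.
by apply: leq_trans (size_npoly a) _; rewrite mk_monic_f size_f.
Qed.

Lemma redq_surj (x : Fq) : exists z : {poly %/ f}, redq z == x.
Proof.
have H (y : B) : exists z, red z == y by have [z <-] := red_surj y; exists z.
pose p := \poly_(i < m) xchoose (H (x : {poly B})`_i).
exists (in_qpoly f p); rewrite redq_in; apply/eqP/val_inj.
have -> : map_poly red p = x.
  apply/polyP => i; rewrite coef_map coef_poly; case: ltnP => im.
    exact/eqP/(xchooseP (H _)).
  rewrite /= rmorph0 nth_default // (leq_trans _ im) //.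
  by apply: leq_trans (size_npoly x) _; rewrite mk_monic_fb size_fb.
by rewrite /= Pdiv.Ring.rmodp_small // size_mk_monic.
Qed.

Lemma redq_eq0 (a : {poly %/ f}) : redq a = 0 -> map_poly red a = 0.
Proof.
move=> /(congr1 val) /=; rewrite mk_monic_fb Pdiv.Ring.rmodp_small //.
rewrite size_fb ltnS (leq_trans _ (size_qpoly a)) //; exact: size_poly.
Qed.

Lemma redq_ker (a : {poly %/ f}) : redq a = 0 -> exists w, a = w *+ 2.
Proof.
move/redq_eq0 => a0.
have H i : exists w, (a : {poly A})`_i == w *+ 2.
  have [|w ew] := @red_ker (a : {poly A})`_i; last by exists w; rewrite ew.
  by rewrite -coef_map a0 coef0.
exists (in_qpoly f (\poly_(i < m) xchoose (H i))); apply/val_inj.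
rewrite mulr2n /= Pdiv.Ring.rmodp_small; last first.
  by apply: leq_ltn_trans (size_poly _ _) _; rewrite mk_monic_f size_f.
apply/polyP => i; rewrite coefD coef_poly; case: ltnP => im.
  by rewrite -mulr2n; exact/eqP/(xchooseP (H i)).
by rewrite addr0 nth_default // (leq_trans (size_qpoly a)).
Qed.

Lemma redq_half (a : {poly %/ f}) : a *+ 2 = 0 -> redq a = 0.
Proof.
rewrite mulr2n => /(congr1 val) /= a0; rewrite /redq (_ : map_poly red a = 0) ?in_qpoly0 //.
apply/polyP => i; rewrite coef_map coef0; apply: red_half.
by rewrite mulr2n -coefD a0 coef0.
Qed.

End Reduction.

(** * The code over the Galois ring *)

Lemma toPE m (z : GR m) : toP z = \sum_(i < m) z 0 i *: 'X^i.
Proof. by apply: eq_bigr => i _; rewrite mul_polyC. Qed.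

Lemma coef_toP m (z : GR m) (i : 'I_m) : (toP z)`_i = z 0 i.
Proof.
rewrite toPE coef_sum (bigD1 i) //= coefZ coefXn eqxx mulr1 big1 ?addr0 // => j ji.
by rewrite coefZ coefXn (_ : (i == j :> nat) = false) ?mulr0 // eq_sym; apply: negbTE.
Qed.

Section GaloisCode.
Variables (R : comNzRingType) (F : finFieldType) (mu : {rmorphism R -> F}).
Variables (m : nat) (f : {poly 'Z_4}) (beta : GR m) (emb : R -> GR m) (unemb : GR m -> R).
Hypotheses (m_odd : odd m) (m_gt1 : (1 < m)%N) (cF : #|F| = (2 ^ m)%N).
Hypothesis R4 : 4 = 0 :> R.
Hypothesis msurj : forall x : F, exists z : R, mu z == x.
Hypothesis mker : forall z : R, mu z = 0 -> exists w, z = w *+ 2.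
Hypothesis mhalf : forall w : R, w *+ 2 = 0 -> mu w = 0.
Hypotheses (embK : cancel emb unemb) (unembK : cancel unemb emb).
Hypothesis embD : forall a b, emb (a + b) = emb a + emb b.
Hypothesis embM : forall a b, grmul f (emb a) (emb b) = emb (a * b).
Hypothesis embX : forall a k, grexp f (emb a) k = emb (a ^+ k).
Hypothesis emb1_0 : (toP (emb 1))`_0 = 1.
Local Notation tau := (tau (mu := mu) m msurj).
Hypothesis teichP : forall z, reflect (exists x : F, z = emb (tau x)) (z \in teich f beta).

Let m_gt0 : (0 < m)%N := ltnW m_gt1.
Local Notation trT := (trT (mu := mu) m msurj).
Ltac inst lem := eapply lem; eassumption.

Let t0 : tau 0 = 0. Proof. inst (@tau0 R F mu m). Qed.
Let tM x y : tau (x * y) = tau x * tau y. Proof. inst (@tauM R F mu m). Qed.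
Let tX x k : tau (x ^+ k) = tau x ^+ k. Proof. inst (@tauX R F mu m). Qed.
Let tD2 x y : tau (x + y) *+ 2 = tau x *+ 2 + tau y *+ 2.
Proof. inst (@tauD2 R F mu m). Qed.
Let trep z : exists x y, z = tau x + tau y *+ 2. Proof. inst (@teich_repr R F mu m). Qed.
Let tuniq x y x' y' : tau x + tau y *+ 2 = tau x' + tau y' *+ 2 -> x = x' /\ y = y'.
Proof. inst (@teich_uniq R F mu m). Qed.
Let mtau x : mu (tau x) = x. Proof. inst (@mu_tau R F mu m). Qed.
Let TD x y : trT (x + y) = trT x + trT y + trT (x * y) *+ 2.
Proof. inst (@trTD R F mu m). Qed.
Let Tsqr x : trT (x ^+ 2) = trT x. Proof. inst (@trT_sqr R F mu m). Qed.
Let T1 : trT 1 = m%:R. Proof. inst (@trT1 R F mu m). Qed.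

Lemma emb0 : emb 0 = 0.
Proof. by apply: (addIr (emb 0)); rewrite -embD !add0r. Qed.

Definition kap (a : R) : 'Z_4 := (toP (emb a))`_0.

Lemma kapD a b : kap (a + b) = kap a + kap b.
Proof. by rewrite /kap embD !(coef_toP _ (Ordinal m_gt0)) mxE. Qed.

Lemma kap_nat k : kap k%:R = k%:R.
Proof.
elim: k => [|k IHk]; first by rewrite /kap emb0 (coef_toP _ (Ordinal m_gt0)) mxE.
by rewrite !(mulrSr 1 k) kapD IHk {1}/kap emb1_0.
Qed.

(** The pair picked by [frob] is the given one by uniqueness of the Teichmuller expansion, and the
    [None] branch contradicts its existence. *)
Lemma frobE x y : frob f beta (emb (tau x + tau y *+ 2)) = emb (tau (x ^+ 2) + tau (y ^+ 2) *+ 2).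
Proof.
rewrite /frob; case: pickP => [[z w] /= /andP [/andP [/teichP [x' ->] /teichP [y' ->]]]|].
  rewrite -!embD -(mulr2n (tau y')) => /eqP /(can_inj embK) /tuniq [-> ->].
  by rewrite !embM -!embD -(mulr2n (_ * _)) !tX !expr2.
move/(_ (emb (tau x), emb (tau y))) => /=.
rewrite -!embD -(mulr2n (tau y)) eqxx andbT => /negbT; rewrite negb_and => /orP [] /teichP []; by eexists.
Qed.

Lemma iter_frobE i x y : iter i (frob f beta) (emb (tau x + tau y *+ 2)) =
  emb (tau (x ^+ (2 ^ i)) + tau (y ^+ (2 ^ i)) *+ 2).
Proof.
elim: i => [|i IHi]; first by rewrite !expr1.
by rewrite iterS IHi frobE -!exprM -!expnSr.
Qed.

Definition Qz (x : F) : 'Z_4 := kap (trT x).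

Lemma trE x y : tr f beta (emb (tau x + tau y *+ 2)) = Qz x + Qz y *+ 2.
Proof.
rewrite /tr /trR; under eq_bigr do rewrite iter_frobE.
rewrite -(big_morph emb embD emb0) -/(kap _) big_split kapD sumrMnl.
by rewrite mulr2n kapD -mulr2n.
Qed.

Let QzD x y : Qz (x + y) = Qz x + Qz y + Qz (x * y) *+ 2.
Proof. by rewrite /Qz TD !kapD. Qed.
Let Qzsqr x : Qz (x ^+ 2) = Qz x.
Proof. by rewrite /Qz Tsqr. Qed.
Let Qz1 : Qz 1 *+ 2 = 2.
Proof.
rewrite /Qz T1 kap_nat -[m](odd_double_half m) m_odd natrD -muln2 natrM.
move: (m./2%:R : 'Z_4) => x; elim/Z4_ind: x; exact/val_inj.
Qed.

Local Notation P := (par F).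
Local Notation pair := (pairing Qz).
Local Notation cl := (cls m Qz).

Let pDr s p r : pair s (addp p r) = pair s p + pair s r.
Proof. inst (@pairingDr F m Qz). Qed.
Let pNr s p : pair s (oppp p) = - pair s p.
Proof. rewrite (@pairingC F Qz) (@pairingC F Qz s); inst (@pairingNl F m Qz). Qed.
Let cl0 p : (cl p == 0) = (p == par0 F).
Proof. inst (@cls_eq0 F m Qz). Qed.
Let adp0 p r : (addp p (oppp r) == par0 F) = (p == r).
Proof. inst (@addp_eq0 F m). Qed.
Let lcl p : lam Qz p = lval m (cl p).
Proof. inst (@lam_cls F m Qz). Qed.

Definition Phi (p : P) : word m :=
  [ffun z => if z \in teich f beta then
     pair (1, mu (unemb z), 0, mu (unemb z) ^+ 3) p else 0].

Lemma teich_tau x : emb (tau x) \in teich f beta.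
Proof. by apply/teichP; exists x. Qed.

Lemma Phi_tau p x : Phi p (emb (tau x)) = pair (1, x, 0, x ^+ 3) p.
Proof. by rewrite ffunE teich_tau embK mtau. Qed.

Lemma cwE u a g c : cw f beta u (emb (tau a + tau g *+ 2)) (emb (tau c)) = Phi (u, a, g ^+ 2, c).
Proof.
apply/ffunP => z; rewrite !ffunE; case: ifP => // /teichP [x ->].
rewrite embK mtau embX embM -embD embM -embD.
have -> : (tau a + tau g *+ 2) * tau x + (tau c + tau c) * tau x ^+ 3 =
   tau (a * x) + tau (g * x + c * x ^+ 3) *+ 2.
  by rewrite tD2 !tM; ring.
rewrite trE (@evE F Qz) /ev mulrC; congr (_ + (_ + _)).
rewrite !(@DD F Qz QzD) (_ : x ^+ 2 * g ^+ 2 = (g * x) ^+ 2); last by ring.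
rewrite (@Dsqr F Qz Qzsqr) [x ^+ 3 * c]mulrC.
by rewrite -(@DD F Qz QzD).
Qed.

Lemma DGP w : reflect (exists p, w = Phi p) (w \in DG f beta).
Proof.
apply: (iffP idP).
  rewrite inE => /existsP [u /existsP [a /existsP [c /andP [/teichP [c' ->] /eqP ->]]]].
  rewrite -(unembK a); have [x [y ->]] := trep (unemb a).
  by exists (u, x, y ^+ 2, c'); rewrite cwE.
case=> -[[[u a] e] c] ->; have [g ->] := @sqr_surj F m cF e.
rewrite inE; apply/existsP; exists u; apply/existsP; exists (emb (tau a + tau g *+ 2)).
by apply/existsP; exists (emb (tau c)); rewrite teich_tau cwE eqxx.
Qed.

Lemma Phi_sub p r : Phi p - Phi r = Phi (addp p (oppp r)).
Proof.
apply/ffunP => z; rewrite !ffunE; case: ifP => _; last by rewrite subr0.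
by rewrite pDr pNr.
Qed.

(** The Lee weight of z in Z_4 is 1 minus the real part of i^z. *)
Lemma leew_Phi p : (leew f beta (Phi p))%:Z = 2 * h m ^+ 2 - lam Qz p.
Proof.
rewrite -(q_hN m_odd) -cF /leew.
rewrite (reindex (fun x : F => emb (tau x))) /=; last first.
  by exists (fun z => mu (unemb z)) => [x _|z /teichP [x ->]]; rewrite embK mtau.
rewrite (eq_bigl xpredT); last by move=> x; exact: teich_tau.
rewrite (big_morph Posz PoszD erefl) -sum1_card (big_morph Posz PoszD erefl) /lam -sumrB.
apply: eq_bigr => x _; rewrite Phi_tau; move: (pair _ _) => z.
by elim/Z4_ind: z.
Qed.

(** If two quadruples give the same word, their difference has Lee weight 0, hence lies in class 0,
    which contains only the zero quadruple. *)
Lemma Phi_inj : injective Phi.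
Proof.
move=> p r e; apply/eqP; rewrite -adp0 -cl0.
suff E : lam Qz (addp p (oppp r)) = 2 * h m ^+ 2.
  by rewrite /cls E; have [-> _ _ _ _] := cls_of_lval m_odd m_gt1 cF ((addp p (oppp r)).2 == 0).
apply/esym/eqP; rewrite -subr_eq0 -leew_Phi -Phi_sub e subrr.
by apply/eqP; congr Posz; rewrite /leew big1 // => z _; rewrite ffunE.
Qed.

Lemma Kerdock_Phi p : (Phi p \in Kerdock f beta) = (p.2 == 0).
Proof.
apply/idP/eqP => [|].
  rewrite inE => /existsP [u /existsP [a /eqP]].
  rewrite -(unembK a); have [x [y ->]] := trep (unemb a).
  by rewrite -emb0 -t0 cwE => /Phi_inj ->.
case: p => [[[u a] e] c] /= ->; have [g ->] := @sqr_surj F m cF e.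
rewrite inE; apply/existsP; exists u; apply/existsP; exists (emb (tau a + tau g *+ 2)).
by rewrite -{1}emb0 -t0 cwE.
Qed.

Let q0 : algC := (2 ^ m)%:R.

Lemma q0_h : q0 = (2 * h m ^+ 2)%:~R.
Proof. by rewrite /q0 -(q_hN m_odd). Qed.

Lemma sqrt_2q : sqrtC (2 * q0) = (2 * h m)%:~R.
Proof.
have -> : 2 * q0 = (2 * h m)%:~R ^+ 2 by rewrite q0_h !(rmorphM intr) /=; ring.
by rewrite sqrCK // ler0z; have := h_ge2 m_odd m_gt1; lia.
Qed.

Lemma sqrt_half_q : sqrtC (q0 / 2) = (h m)%:~R.
Proof.
have -> : q0 / 2 = (h m)%:~R ^+ 2 by rewrite q0_h !(rmorphM intr) /=; field.
by rewrite sqrCK // ler0z; have := h_ge2 m_odd m_gt1; lia.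
Qed.

(** As w = q - lam and both square roots are integers, each clause of [Srel] becomes an integer
    equation equivalent to lam = [lval m i], with the Kerdock flag for classes 3 and 4. *)
Lemma Srel_cls p i x y : x - y = Phi p -> Srel f beta i x y = (cl p == i).
Proof.
move=> xy; rewrite /Srel xy Kerdock_Phi -/q0 sqrt_2q sqrt_half_q.
have -> : (leew f beta (Phi p))%:R = (2 * h m ^+ 2 - lam Qz p)%:~R :> algC.
  by rewrite -leew_Phi.
have E2 : 2 * q0 = (2 * h m ^+ 2 + 2 * h m ^+ 2)%:~R.
  by rewrite q0_h (rmorphD intr) /=; ring.
rewrite {}E2 q0_h -!(rmorphB intr) -!(rmorphD intr) /= -[0](rmorph0 intr) !eqr_int.
have := lcl p; rewrite /cls; move: (lam Qz p) (p.2 == 0) => l k lE.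
have [c0 c1 c2 c3 [c5 c6 c7]] := cls_of_lval m_odd m_gt1 cF k.
have conv j : cls_of m l k = j -> l = lval m j by move=> <-.
have hyp v j : cls_of m v k = j -> (l = v -> cls_of m l k == j) by move=> <- ->.
have conv3 j : j = 3 \/ j = 4 -> cls_of m l k = j -> l = 0 /\ (if k then 3 else 4) = j.
  move=> j34 e; have l0 : l = 0 by rewrite (conv j e); case: j34 => ->.
  by split=> //; rewrite -e l0 c3.
elim/I8_ind: i => /=; apply/idP/idP.
- by move/eqP => e; apply: hyp c0 _; lia.
- by move/eqP/conv => ->; rewrite subrr.
- by move/eqP => e; apply: hyp c1 _; lia.
- by move/eqP/conv => ->.
- by move/eqP => e; apply: hyp c2 _; lia.
- by move/eqP/conv => ->.
- by case/andP => /eqP e kT; move: c3; rewrite kT in hyp *; move=> c3; apply: hyp c3 _; lia.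
- by case/eqP/(conv3 3 (or_introl erefl)) => ->; rewrite subr0 eqxx; case: (k).
- by case/andP => /eqP e /negPf kF; move: c3; rewrite kF in hyp *; move=> c3; apply: hyp c3 _; lia.
- by case/eqP/(conv3 4 (or_intror erefl)) => ->; rewrite subr0 eqxx; case: (k).
- by move/eqP => e; apply: hyp c5 _; lia.
- by move/eqP/conv => ->; rewrite opprK.
- by move/eqP => e; apply: hyp c6 _; lia.
- by move/eqP/conv => ->; rewrite opprK.
- by move/eqP => e; apply: hyp c7 _; lia.
- by move/eqP/conv => ->; rewrite opprK.
Qed.

Lemma addr_DG x y : x \in DG f beta -> y \in DG f beta -> x - y \in DG f beta.
Proof. by move=> /DGP [p ->] /DGP [r ->]; apply/DGP; exists (addp p (oppp r)); exact: Phi_sub. Qed.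

Lemma DG0 : 0 \in DG f beta.
Proof. by apply/DGP; exists (par0 F); rewrite -(subrr (Phi (par0 F))) Phi_sub; congr Phi; apply/eqP; rewrite adp0. Qed.

Lemma DG_translation : translation_scheme (mem (DG f beta)) (Srel f beta).
Proof.
split; [exact: DG0 | exact: addr_DG |] => i x y z _ _ _.
by rewrite /Srel opprD addrACA subrr addr0.
Qed.

Lemma card_DG : #|DG f beta| = (4 * (2 ^ m) ^ 3)%N.
Proof.
rewrite -cF -(@card_par F) -(card_imset predT Phi_inj); apply: eq_card => w.
by apply/DGP/imsetP => [[p ->]|[p _ ->]]; exists p.
Qed.

Lemma DG_par (a : 'I_#|DG f beta|) : exists p, Phi p == enum_val a.
Proof. by have /DGP [p e] := enum_valP a; exists p; rewrite e. Qed.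

Definition par_of a : P := xchoose (DG_par a).

Lemma Phi_par_of a : Phi (par_of a) = enum_val a.
Proof. exact/eqP/(xchooseP (DG_par a)). Qed.

Lemma par_of_bij : bijective par_of.
Proof.
have inD p : Phi p \in DG f beta by apply/DGP; exists p.
exists (fun p => enum_rank_in DG0 (Phi p)) => [a|p].
  by rewrite Phi_par_of enum_valK_in.
by apply: Phi_inj; rewrite Phi_par_of enum_rankK_in.
Qed.

Lemma DGrel_cls i a b : DGrel m f beta i a b = (cl (addp (par_of a) (oppp (par_of b))) == i).
Proof. by apply: Srel_cls; rewrite -!Phi_par_of Phi_sub. Qed.

Theorem DG_scheme : let s : algC := sqrtC (2 * (2 ^ m)%:R) in
  [/\ translation_scheme (mem (DG f beta)) (Srel f beta),
      is_assoc_scheme (DGrel m f beta),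
      commutative_scheme (DGrel m f beta),
      symmetric_scheme (DGrel m f beta) &
      exists E : 'I_8 -> 'M[algC]_#|DG f beta|,
        [/\ primitive_idem_enum (DGadj m f beta) E,
            first_eigenmatrix (DGadj m f beta) E (Pmx s),
            Pmx s \in unitmx &
            second_eigenmatrix (DGadj m f beta) E
              ((4 * (2 ^ m) ^ 3)%:R *: invmx (Pmx s))]].
Proof.
move=> s; have [S1 S2 S3 [E E4]] :=
  cls_scheme m_odd m_gt1 cF QzD Qzsqr Qz1 par_of_bij DGrel_cls.
split=> //; first exact: DG_translation.
by exists E; rewrite /s sqrt_2q -card_DG; exact: E4.
Qed.

End GaloisCode.

(** * The Teichmuller set of Z_4[x]/(f) *)

Opaque tau.

Section GaloisRing.
Variables (m : nat) (f : {poly 'Z_4}) (beta : GR m).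
Hypotheses (m_odd : odd m) (m_gt1 : (1 < m)%N).
Hypotheses (f_monic : f \is monic) (size_f : size f = m.+1).
Hypothesis f_irr : irreducible_poly (map_poly red2 f).
Hypothesis beta_ord : beta_order f beta.

Let m_gt0 : (0 < m)%N := ltnW m_gt1.
Local Notation R := {poly %/ f}.
Local Notation F := (Fq (red := red2) f_monic f_irr).
Local Notation mu := (redM (red := red2) m_gt0 f_monic size_f f_irr).

Let cF : #|{: F}| = (2 ^ m)%N.
Proof. by rewrite (card_Fq f_monic size_f) card_Fp. Qed.

Let R4 : 4 = 0 :> R.
Proof.
have e : 1 *+ 4 = 0 :> {poly 'Z_4} by rewrite -polyC1 -polyCMn; congr (_%:P); apply/val_inj.
by rewrite -(in_qpoly1 f) -(raddfMn (in_qpoly f)) e raddf0.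
Qed.

Let msurj : forall x : F, exists z : R, mu z == x.
Proof.
apply: (redq_surj m_gt0 size_f) => x; exists (val x)%:R; exact: red2_lift.
Qed.

Let mker (z : R) : mu z = 0 -> exists w, z = w *+ 2.
Proof. exact: (redq_ker m_gt0 f_monic size_f red2_ker). Qed.

Let mhalf (w : R) : w *+ 2 = 0 -> mu w = 0.
Proof. exact: (redq_half red2_half). Qed.

Local Notation tau := (tau (mu := mu) m msurj).

Ltac inst lem := eapply lem; eassumption.

Let t0 : tau 0 = 0. Proof. inst (@tau0 R F mu m). Qed.
Let tK z : z ^+ (2 ^ m) = z -> tau (mu z) = z. Proof. inst (@tauK R F mu m). Qed.

Definition emb (a : R) : GR m := \row_i (a : {poly 'Z_4})`_i.
Definition unemb (z : GR m) : R := in_qpoly f (toP z).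

Lemma size_toP (z : GR m) : (size (toP z) <= m)%N.
Proof.
rewrite toPE; apply: (leq_trans (size_sum _ _ _)); apply/bigmax_leqP => i _.
by apply: leq_trans (size_scale_leq _ _) _; rewrite size_polyXn.
Qed.

Lemma toP_emb a : toP (emb a) = a.
Proof.
apply/polyP => i; case: (ltnP i m) => im.
  by rewrite (coef_toP (emb a) (Ordinal im)) mxE.
rewrite !nth_default //; first exact: leq_trans (size_qpoly m_gt0 f_monic size_f a) im.
exact: leq_trans (size_toP _) im.
Qed.

Lemma embK : cancel emb unemb.
Proof.
move=> a; apply/val_inj; rewrite /unemb toP_emb /= Pdiv.Ring.rmodp_small //.
by apply: leq_ltn_trans (size_qpoly m_gt0 f_monic size_f a) _; rewrite (mk_monic_f m_gt0) ?size_f.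
Qed.

Lemma unembK : cancel unemb emb.
Proof.
move=> z; apply/rowP => i; rewrite mxE /unemb /= Pdiv.Ring.rmodp_small ?coef_toP //.
by rewrite (mk_monic_f m_gt0 f_monic size_f) size_f ltnS size_toP.
Qed.

Lemma embD a b : emb (a + b) = emb a + emb b.
Proof. by apply/rowP => i; rewrite !mxE coefD. Qed.

Lemma coef_emb0 : emb 0 = 0.
Proof. by apply/rowP => i; rewrite !mxE coef0. Qed.

Lemma ofP_emb p : ofP m f p = emb (in_qpoly f p).
Proof. by apply/rowP => i; rewrite !mxE /= (mk_monic_f m_gt0 f_monic size_f). Qed.

Lemma embM a b : grmul f (emb a) (emb b) = emb (a * b).
Proof. by rewrite /grmul !toP_emb ofP_emb. Qed.

Lemma emb1 : grone m f = emb 1.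
Proof. by rewrite /grone ofP_emb in_qpoly1. Qed.

Lemma embX a k : grexp f (emb a) k = emb (a ^+ k).
Proof. by elim: k => [|k IHk]; [exact: emb1 | rewrite exprS -embM -IHk]. Qed.

Let b := unemb beta.
Let n := (2 ^ m - 1)%N.

Lemma n_gt0 : (0 < n)%N.
Proof. by rewrite subn_gt0 -[1%N]/(2 ^ 0)%N ltn_exp2l. Qed.

Lemma n_odd : odd n.
Proof. by rewrite oddB ?expn_gt0 // oddX; case: (m) m_gt0. Qed.

Lemma nS : n.+1 = (2 ^ m)%N.
Proof. by rewrite /n subn1 prednK ?expn_gt0. Qed.

Lemma bn : b ^+ n = 1.
Proof.
apply: (can_inj embK); rewrite -embX -emb1 unembK; by case: beta_ord.
Qed.

Lemma b_order k : (0 < k < n)%N -> b ^+ k != 1.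
Proof.
move=> kn; apply/eqP => e; case: beta_ord => _ /(_ k kn) /eqP; apply.
by rewrite -(unembK beta) embX -/b e emb1.
Qed.

(** If mu b^k = 1 then b^(2k) = 1, as squares depend only on residues. Since 0 < 2k < 2n and b has
    order n, this forces 2k = n, impossible for n odd. *)
Lemma mu_b_order k : (0 < k < n)%N -> mu b ^+ k != 1.
Proof.
case/andP => k0 kn; apply/eqP => e.
have b2 : b ^+ (k * 2) = 1.
  have := @sqr_eq_mu _ _ mu R4 mker (b ^+ k) 1.
  by rewrite exprM expr1n; apply; rewrite rmorphXn rmorph1.
have nn := n_odd.
case: (ltngtP (k * 2) n) => h.
- by have := @b_order (k * 2); rewrite muln_gt0 k0 h b2 eqxx => /(_ isT).
- have : b ^+ (k * 2 - n) = 1 by rewrite -[LHS]mul1r -{1}bn -exprD subnKC ?(ltnW h).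
  move=> e2; have := @b_order (k * 2 - n); rewrite subn_gt0 h e2 eqxx.
  have -> : (k * 2 - n < n)%N by move: kn h; lia.
  by move/(_ isT).
- by move: nn; rewrite -h muln2 odd_double.
Qed.

Lemma mu_b_neq0 : mu b != 0.
Proof.
apply/eqP => e; have : mu (b ^+ n) = 0 by rewrite rmorphXn e expr0n eqn0Ngt n_gt0.
by rewrite bn rmorph1 => /eqP; rewrite oner_eq0.
Qed.

(** The n = q - 1 powers of mu b are distinct and nonzero, so they exhaust the nonzero elements of
    F. *)
Lemma mu_b_gen (x : F) : x != 0 -> exists2 k, (k < n)%N & x = mu b ^+ k.
Proof.
move=> x0; have inj : injective (fun k : 'I_n => mu b ^+ k).
  have wl (i j : 'I_n) : mu b ^+ i = mu b ^+ j -> (i <= j)%N -> i = j.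
    move=> e ij; apply/val_inj; apply/eqP; rewrite eqn_leq ij leqNgt /=; apply/negP => lt.
    have /negP : mu b ^+ (j - i) != 1.
      apply: mu_b_order; rewrite subn_gt0 lt /=; exact: leq_ltn_trans (leq_subr _ _) (ltn_ord j).
    apply; apply/eqP; apply: (mulfI (expf_neq0 i mu_b_neq0)).
    by rewrite -exprD subnKC // mulr1 e.
  move=> i j e; case: (leqP i j) => ij; first exact: wl.
  by apply/esym/wl => //; exact: ltnW.
have sub : [set mu b ^+ (k : 'I_n) | k : 'I_n] \subset [set~ 0].
  by apply/subsetP => y /imsetP [k _ ->]; rewrite !inE expf_neq0 // mu_b_neq0.
have : x \in [set mu b ^+ (k : 'I_n) | k : 'I_n].
  suff -> : [set mu b ^+ (k : 'I_n) | k : 'I_n] = [set~ 0] by rewrite !inE.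
  apply/eqP; rewrite eqEcard sub card_imset // card_ord cardsC1 cF.
  by rewrite /n subn1 andTb leqnn.
by case/imsetP => k _ ->; exists k.
Qed.

Lemma b_fix k : (b ^+ k) ^+ (2 ^ m) = b ^+ k.
Proof. by rewrite -exprM mulnC exprM -nS exprSr bn mul1r. Qed.

(** Powers of b are fixed by z |-> z^q, and on such elements tau inverts mu. *)
Lemma tau_bX k : tau (mu b ^+ k) = b ^+ k.
Proof. by rewrite -rmorphXn; apply/tK/b_fix. Qed.

Lemma betaX k : grexp f beta k = emb (b ^+ k).
Proof. by rewrite -(unembK beta) embX. Qed.

Lemma teichP z : reflect (exists x : F, z = emb (tau x)) (z \in teich f beta).
Proof.
apply: (iffP idP) => [|[x ->]].
  rewrite inE => /orP [/eqP ->|/existsP [k /eqP ->]].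
    by exists 0; rewrite t0 coef_emb0.
  by exists (mu b ^+ k); rewrite tau_bX betaX.
rewrite inE; case: (eqVneq x 0) => [->|x0]; first by rewrite t0 coef_emb0 eqxx.
apply/orP; right; have [k kn ->] := mu_b_gen x0.
by apply/existsP; exists (Ordinal kn); rewrite betaX tau_bX.
Qed.

Theorem GR_scheme : let s : algC := sqrtC (2 * (2 ^ m)%:R) in
  [/\ translation_scheme (mem (DG f beta)) (Srel f beta),
      is_assoc_scheme (DGrel m f beta),
      commutative_scheme (DGrel m f beta),
      symmetric_scheme (DGrel m f beta) &
      exists E : 'I_8 -> 'M[algC]_#|DG f beta|,
        [/\ primitive_idem_enum (DGadj m f beta) E,
            first_eigenmatrix (DGadj m f beta) E (Pmx s),
            Pmx s \in unitmx &
            second_eigenmatrix (DGadj m f beta) E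
              ((4 * (2 ^ m) ^ 3)%:R *: invmx (Pmx s))]].
Proof.
have emb1_0 : (toP (emb (1 : R)))`_0 = 1.
  by rewrite toP_emb /= coef1.
exact: (@DG_scheme R F mu m f beta emb unemb m_odd m_gt1 cF R4 msurj mker mhalf
  embK unembK embD embM embX emb1_0 teichP).
Qed.

End GaloisRing.

Theorem theorem3p1 (m : nat) (f : {poly 'Z_4}) (beta : GR m) :
  odd m -> (1 < m)%N ->
  f \is monic -> size f = m.+1 -> irreducible_poly (map_poly red2 f) ->
  beta_order f beta ->
  let q : nat := (2 ^ m)%N in
  let s : algC := sqrtC (2 * q%:R) in
  [/\ translation_scheme (mem (DG f beta)) (Srel f beta),
      is_assoc_scheme (DGrel m f beta),
      commutative_scheme (DGrel m f beta),
      symmetric_scheme (DGrel m f beta) &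
      exists E : 'I_8 -> 'M[algC]_#|DG f beta|,
        [/\ primitive_idem_enum (DGadj m f beta) E,
            first_eigenmatrix (DGadj m f beta) E (Pmx s),
            Pmx s \in unitmx &
            second_eigenmatrix (DGadj m f beta) E
              ((4 * q ^ 3)%:R *: invmx (Pmx s))]].
Proof. by move=> m_odd m_gt1 fm sf fi bo; exact: (GR_scheme m_odd m_gt1 fm sf fi bo). Qed.
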